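(* Let $\mathcal{A}$ be a cluster algebra of rank $n$ with coefficients in a semifield $\mathbb{P}$, given by a cluster pattern $t\mapsto(\mathbf x_t,\mathbf y_t,B_t)$ on $\mathbb{T}_n$ whose exchange matrices form a pattern of totally sign-skew-symmetric matrices satisfying the Assumption. Then: (1) if $\sigma\in S_n$ and $t,t'\in\mathbb{T}_n$ satisfy $\sigma(\mathbf x_{t'})=\mathbf x_t$, then $(\mathbf x_t,\mathbf y_t,B_t)=\sigma(\mathbf x_{t'},\mathbf y_{t'},B_{t'})$; (2) for $t,t'\in\mathbb{T}_n$, the unlabeled seeds of $(\mathbf x_t,\mathbf y_t,B_t)$ and $(\mathbf x_{t'},\mathbf y_{t'},B_{t'})$ are adjacent in the exchange graph if and only if the clusters $\{x_{1,t},\dots,x_{n,t}\}$ and $\{x_{1,t'},\dots,x_{n,t'}\}$ have exactly $n-1$ common cluster variables.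
   Context: For real $a$, $[a]_+=\max(a,0)$. An integer $n\times n$ matrix $B=(b_{ij})$ is sign-skew-symmetric if $b_{ij}b_{ji}\le0$ and $b_{ij}b_{ji}=0$ implies $b_{ij}=b_{ji}=0$; its mutation at $k$ is $\mu_k(B)=(b'_{ij})$ with $b'_{ij}=-b_{ij}$ if $i=k$ or $j=k$, and $b'_{ij}=b_{ij}+\mathrm{sign}(b_{ik})[b_{ik}b_{kj}]_+$ otherwise; $B$ is totally sign-skew-symmetric if all matrices obtained by finitely many mutations are sign-skew-symmetric. A semifield $\mathbb{P}$ is an abelian multiplicative group with a commutative associative addition $\oplus$ distributive over multiplication; $\mathbb{QP}$ is the fraction field of $\mathbb{ZP}$. A seed is $(\mathbf x,\mathbf y,B)$ with $\mathbf x=(x_1,\dots,x_n)$ a free generating set of a field $\mathcal F$ of rational functions over $\mathbb{QP}$, $\mathbf y=(y_1,\dots,y_n)\in\mathbb{P}^n$, $B$ totally sign-skew-symmetric. Its mutation $\mu_k$ gives $(\mathbf x',\mathbf y',B')$ with $B'=\mu_k(B)$, $x'_i=x_i$ ($i\ne k$), $x'_k=\frac{y_k\prod_i x_i^{[b_{ik}]_+}+\prod_i x_i^{[-b_{ik}]_+}}{(y_k\oplus1)x_k}$, $y'_k=y_k^{-1}$, $y'_i=y_iy_k^{[b_{ki}]_+}(y_k\oplus1)^{-b_{ki}}$ ($i\ne k$). $\mathbb{T}_n$ is the $n$-regular tree with edges labeled $1,\dots,n$, distinct at each vertex. A cluster pattern assigns a seed $(\mathbf x_t,\mathbf y_t,B_t)$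 to each $t$ with adjacent seeds related by mutation at the edge label; the $x_{i,t}$ are cluster variables, $\mathbf x_t$ clusters. For $\sigma\in S_n$: $\sigma(\mathbf x_t)=(x_{\sigma(1),t},\dots,x_{\sigma(n),t})$, $\sigma(\mathbf y_t)=(y_{\sigma(1),t},\dots,y_{\sigma(n),t})$, $\sigma(B_t)=(b_{\sigma(i)\sigma(j),t})$. Seeds differing by such a simultaneous permutation define the same unlabeled seed; the exchange graph has the unlabeled seeds as vertices, two being joined if related by a single mutation. Matrix notation: $[A]_+$ entrywise positive part; $A^{k\cdot}$ (resp. $A^{\cdot k}$) keeps only the $k$-th row (resp. column); $J_k$ is the identity with $(k,k)$ entry $-1$. For an exchange matrix pattern $(M_t)$ (i.e. $M_{t'}=\mu_k(M_t)$ along edges labeled $k$) and vertex $s$, the $C$-matrices are $C^{s}_{s}=I_n$ and $C^{s}_{t'}=C^{s}_t(J_k+[M_t]_+^{k\cdot})+[-C^{s}_t]_+^{\cdot k}M_t$ along edges $t\overset{k}{\text{---}}t'$ moving away from $s$ (the $C$-matrices of the principal-coefficient cluster algebra with initial matrix $M_s$); their columns are known to be nonzero and sign-coherent, and $\varepsilon_k(C)$ is the sign of the $k$-th column. Assumption (for the pattern $(B_t)$): for every $s\in\mathbb{T}_n$ and each $(M_t)\in\{(B_t),(-B_t)\}$, for all $t$ and $k$, $\varepsilon_k$ of the $C$-matrix at $t$ (initial vertex $s$) of $(M_t)$ equals $\varepsilon_k$ of the $C$-matrix at $t$ (initial vertex $s$) of $(-M_t^T)$. *)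

(* Defs.v *)
From HB Require Import structures.
From mathcomp Require Import all_boot all_order all_algebra.
From mathcomp Require Import perm finmap mpoly.

Set Implicit Arguments.
Unset Strict Implicit.
Unset Printing Implicit Defensive.

Import Order.TTheory GRing.Theory Num.Theory.
Local Open Scope ring_scope.

(** * Exchange matrices *)

Definition pospart (a : int) : int := Num.max a 0.

Definition sign_skew_symmetric n (B : 'M[int]_n) : Prop :=
  forall i j, B i j * B j i <= 0 /\
    (B i j * B j i = 0 -> B i j = 0 /\ B j i = 0).

Definition mx_mut n (k : 'I_n) (B : 'M[int]_n) : 'M[int]_n :=
  \matrix_(i, j)
    if (i == k) || (j == k) then - B i j
    else B i j + Num.sg (B i k) * pospart (B i k * B k j).

Definition totally_sign_skew_symmetric n (B : 'M[int]_n) : Prop :=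
  forall ks : seq 'I_n, sign_skew_symmetric (foldr (@mx_mut n) B ks).

(** * Semifields *)

HB.mixin Record Group_isSemifield P of Group P := {
  oplus : P -> P -> P;
  sf_mulC : forall p q : P, (p * q)%g = (q * p)%g;
  oplusA : associative oplus;
  oplusC : commutative oplus;
  sf_mulDr : forall p q r : P,
    (p * oplus q r)%g = oplus (p * q)%g (p * r)%g
}.

#[short(type="semifieldType")]
HB.structure Definition Semifield := {P of Group_isSemifield P & Group P}.

Definition expgz (P : groupType) (p : P) (m : int) : P :=
  match m with
  | Posz a => (p ^+ a)%g
  | Negz a => (p ^- a.+1)%g
  end.

(** * The fraction field of the group ring *)

(* Elements of the group ring ZP are finitely supported functions a : P -> int,
   standing for the formal sums of the a p times [p].  [zp_eval iota] is the
   additive extension of iota to ZP; it is the induced ring morphism when iota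
   is multiplicative. *)
Definition zp_eval (P : semifieldType) (K : fieldType) (iota : P -> K)
    (a : {fsfun P -> int with 0}) : K :=
  \sum_(p <- finsupp a) (a p)%:~R * iota p.

(* K, together with iota : P -> K, is a fraction field of ZP: the ring morphism
   ZP -> K induced by iota is injective and every element of K is a quotient
   of two elements of its image.  This determines (K, iota) up to a unique
   isomorphism. *)
Record is_QP (P : semifieldType) (K : fieldType) (iota : P -> K) : Prop := {
  QP_one : iota 1%g = 1;
  QP_mul : forall p q : P, iota (p * q)%g = iota p * iota q;
  QP_inj : forall a : {fsfun P -> int with 0},
    zp_eval iota a = 0 -> forall p, a p = 0;
  QP_frac : forall z : K, exists a b : {fsfun P -> int with 0},
    zp_eval iota b != 0 /\ z = zp_eval iota a / zp_eval iota b
}.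

(* x is algebraically independent over K, and F = K(x). *)
Definition free_generating_set n (K F : fieldType) (phi : {rmorphism K -> F})
    (x : {ffun 'I_n -> F}) : Prop :=
  (forall p : {mpoly K[n]}, mmap phi x p = 0 -> p = 0) /\
  (forall z : F, exists p q : {mpoly K[n]},
     mmap phi x q != 0 /\ z = mmap phi x p / mmap phi x q).

(** * Seeds *)

Record seed (n : nat) (P : semifieldType) (F : fieldType) := Seed {
  clu : {ffun 'I_n -> F};
  coef : {ffun 'I_n -> P};
  exmx : 'M[int]_n
}.

Definition is_seed n (P : semifieldType) (K F : fieldType)
    (phi : {rmorphism K -> F}) (S : seed n P F) : Prop :=
  free_generating_set phi (clu S) /\ totally_sign_skew_symmetric (exmx S).

Section Mutation.
Variables (n : nat) (P : semifieldType) (F : fieldType).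
(* the inclusion of P in F *)
Variable emb : P -> F.
Implicit Types (S : seed n P F) (k : 'I_n).

Definition clu_mut k S : {ffun 'I_n -> F} :=
  [ffun i => if i == k then
     (emb (coef S k) * (\prod_j clu S j ^ pospart (exmx S j k))
        + \prod_j clu S j ^ pospart (- exmx S j k))
     / (emb (oplus (coef S k) 1%g) * clu S k)
   else clu S i].

Definition coef_mut k S : {ffun 'I_n -> P} :=
  [ffun i => if i == k then (coef S k)^-1%g
   else (coef S i * expgz (coef S k) (pospart (exmx S k i))
           * expgz (oplus (coef S k) 1%g) (- exmx S k i)%R)%g].

Definition seed_mut k S : seed n P F :=
  Seed (clu_mut k S) (coef_mut k S) (mx_mut k (exmx S)).

End Mutation.

Section Unlabeled.
Variables (n : nat) (P : semifieldType) (F : fieldType).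
Implicit Types (S : seed n P F) (s : 'S_n).

Definition perm_ffun (T : Type) s (f : {ffun 'I_n -> T}) : {ffun 'I_n -> T} :=
  [ffun i => f (s i)].

Definition perm_seed s S : seed n P F :=
  Seed (perm_ffun s (clu S)) (perm_ffun s (coef S)) (mxsub s s (exmx S)).

Definition same_unlabeled_seed S S' : Prop := exists s, S' = perm_seed s S.

(* The edges of the exchange graph, on representatives of unlabeled seeds. *)
Definition exchange_adjacent (emb : P -> F) S S' : Prop :=
  exists (S1 S1' : seed n P F) (k : 'I_n),
    [/\ same_unlabeled_seed S S1, same_unlabeled_seed S' S1'
      & S1' = seed_mut emb k S1].

Definition cluster S : {fset F} := [fset clu S i | i in 'I_n]%fset.

End Unlabeled.

(** * The n-regular tree *)

(* Vertices of T_n are the words without two equal consecutive letters in the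
   edge labels, i.e., the elements of the free product of n copies of Z/2; the
   edge labeled k at w joins w to the reduced form of k :: w.  Words are thus
   read from right to left. *)
Definition reduced n (w : seq 'I_n) : bool := sorted (fun i j => i != j) w.

Definition push n (k : 'I_n) (w : seq 'I_n) : seq 'I_n :=
  if w is j :: w' then if j == k then w' else k :: w else [:: k].

Lemma reduced_push n (k : 'I_n) w : reduced w -> reduced (push k w).
Proof.
case: w => //= j w rw; case: eqP => [_|/eqP jk]; first exact: path_sorted rw.
by rewrite /reduced /= eq_sym jk.
Qed.

Definition tree (n : nat) : Type := {w : seq 'I_n | reduced w}.

Definition root n : tree n := exist _ [::] isT.

Definition nbr n (k : 'I_n) (t : tree n) : tree n :=
  exist _ (push k (val t)) (reduced_push k (valP t)).

Definition walk n (s : tree n) (w : seq 'I_n) : tree n := foldr (@nbr n) s w.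

(* The labels of the path from s to t, last edge first: the reduced form of
   the product t * s^-1. *)
Definition geodesic n (s t : tree n) : seq 'I_n :=
  foldr (@push n) (rev (val s)) (val t).

Lemma pushK n (k : 'I_n) w : reduced w -> push k (push k w) = w.
Proof.
case: w => [|j w] rw /=; first by rewrite eqxx.
case: eqP => [<-|_]; last by rewrite /= eqxx.
by case: w rw => [|i w] //= /andP[ji _]; rewrite eq_sym (negPf ji).
Qed.

Lemma nbrK n (k : 'I_n) : involutive (nbr k).
Proof. by move=> t; apply/val_inj/pushK/valP. Qed.

Lemma reduced_geodesic n (s t : tree n) : reduced (geodesic s t).
Proof.
rewrite /geodesic; elim: (val t) => [|k w IH] /=; last exact: reduced_push.
rewrite /reduced rev_sorted; have := valP s; rewrite /reduced.
by congr is_true; apply: eq_sorted => i j /=; rewrite eq_sym.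
Qed.

Lemma walk_push n (s : tree n) k w :
  walk s (push k w) = nbr k (walk s w).
Proof. by case: w => //= j w; case: eqP => [->|_] //; rewrite nbrK. Qed.

Lemma walk_geodesic n (s t : tree n) : walk s (geodesic s t) = t.
Proof.
have rootE (u : tree n) : walk (root n) (val u) = u.
  apply: val_inj; case: u => /= w; elim: w => //= k w IH rw.
  rewrite IH; last exact: path_sorted rw.
  by case: w rw {IH} => //= j w /andP[kj _]; rewrite eq_sym (negPf kj).
have back v : walk (walk (root n) v) (rev v) = root n.
  elim: v => //= k v IH.
  by rewrite rev_cons -cats1 /walk foldr_cat /= nbrK -/(walk _ _) -/(walk _ _).
have -> : walk s (geodesic s t) = walk (root n) (val t); last exact: rootE.
rewrite /geodesic; elim: (val t) => /= [|k w IH]; last by rewrite walk_push IH.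
by rewrite -[X in walk X _]rootE back.
Qed.

Lemma geodesic_nbr n (s t : tree n) k :
  geodesic s (nbr k t) = push k (geodesic s t).
Proof.
rewrite /geodesic /nbr /=; case: (val t) => //= j w.
case: eqP => [->|_] //; rewrite pushK //.
elim: w => [|i w IH] /=; last exact: reduced_push.
exact: (@reduced_geodesic _ s (root n)).
Qed.

Lemma geodesicss n (s : tree n) : geodesic s s = [::].
Proof.
rewrite /geodesic; suff E w v : foldr (@push n) (rev w ++ v) w = v.
  by have := E (val s) [::]; rewrite cats0.
elim: w v => //= k w IH v.
by rewrite rev_cons cat_rcons IH /= eqxx.
Qed.

(** * C-matrices *)

Definition pos_mx n (A : 'M[int]_n) : 'M[int]_n := map_mx pospart A.

Definition krow n (k : 'I_n) (A : 'M[int]_n) : 'M[int]_n :=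
  \matrix_(i, j) if i == k then A i j else 0.

Definition kcol n (k : 'I_n) (A : 'M[int]_n) : 'M[int]_n :=
  \matrix_(i, j) if j == k then A i j else 0.

Definition Jmx n (k : 'I_n) : 'M[int]_n :=
  diag_mx (\row_i if i == k then -1 else 1).

Definition C_step n (k : 'I_n) (M C : 'M[int]_n) : 'M[int]_n :=
  C *m (Jmx k + krow k (pos_mx M)) + kcol k (pos_mx (- C)) *m M.

Fixpoint C_along n (M : tree n -> 'M[int]_n) (s : tree n) (w : seq 'I_n) :
    'M[int]_n :=
  if w is k :: w' then C_step k (M (walk s w')) (C_along M s w') else 1%:M.

Definition Cmx n (M : tree n -> 'M[int]_n) (s t : tree n) : 'M[int]_n :=
  C_along M s (geodesic s t).

Lemma Cmx_init n (M : tree n -> 'M[int]_n) s : Cmx M s s = 1%:M.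
Proof. by rewrite /Cmx geodesicss. Qed.

Lemma Cmx_step n (M : tree n -> 'M[int]_n) s t k :
  (size (geodesic s t) < size (geodesic s (nbr k t)))%N ->
  Cmx M s (nbr k t) = C_step k (M t) (Cmx M s t).
Proof.
rewrite /Cmx geodesic_nbr => lt_st.
have -> : push k (geodesic s t) = k :: geodesic s t.
  move: lt_st; case: (geodesic s t) => //= j w.
  by case: eqP => //= _; rewrite ltnNge leqnSn.
by rewrite /= walk_geodesic.
Qed.

(* e is the sign of the k-th column of C, a nonzero sign-coherent vector. *)
Definition column_sign n (C : 'M[int]_n) (k : 'I_n) (e : int) : Prop :=
  [/\ e = 1 \/ e = -1, exists i, C i k != 0 & forall i, 0 <= e * C i k].

(* Since the sign of a column is only defined when that column is nonzero and
   sign-coherent, equality of two column signs means that both exist and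
   coincide. *)
Definition same_column_sign n (C C' : 'M[int]_n) (k : 'I_n) : Prop :=
  exists e, column_sign C k e /\ column_sign C' k e.

Definition sign_assumption n (B : tree n -> 'M[int]_n) : Prop :=
  forall M : tree n -> 'M[int]_n, M = B \/ M = (fun t => - B t) ->
  forall (s t : tree n) (k : 'I_n),
    same_column_sign (Cmx M s t) (Cmx (fun u => - (M u)^T) s t) k.

(** * Cluster patterns *)

Definition cluster_pattern n (P : semifieldType) (K F : fieldType)
    (iota : P -> K) (phi : {rmorphism K -> F}) (S : tree n -> seed n P F) :
    Prop :=
  (forall t, is_seed phi (S t)) /\
  (forall t k, S (nbr k t) = seed_mut (fun p => phi (iota p)) k (S t)).

(* Main.v *)
(** Sign-coherence makes every C-step right multiplication by an involution
    J_k + [e M]_+^{k.}.  Since M and - M^T have the same signs e, an induction on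
    the distance between s and t shows that the C-matrices of M from s to t and
    of - M from t to s are mutually inverse; hence the G-matrix, the inverse
    transpose of the C-matrix of - M^T, has sign-coherent rows.

    The cluster variable x_{i,t} is the monomial x_s^{g_i} times the value of
    F_{i,t} at yhat, up to a coefficient.  F_{i,t} is a Laurent polynomial (by the
    caterpillar argument, which in terms of F only needs two polynomials not to
    vanish at X_i = -1), so its tropical evaluation is superadditive; it vanishes
    on nonnegative vectors, hence is nonpositive everywhere.  An equality
    x_{i,t} = x_{j,s} therefore gives, for every tropical point a, the inequality
    <g_i, a> >= a_j, that is g_i = e_j.

    If the G-matrix is the matrix of a permutation, so is the C-matrix: it and
    its inverse have nonnegative entries, and comparing signs at the neighbours
    of s identifies the permutation.  The F-polynomials from s to t and those
    from t back to s multiply to monomials; being tropically nonpositive they are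
    all 1, and the two seeds agree.  Two clusters with n - 1 common variables are
    reduced to this case, after one mutation if necessary, because sign-coherence
    of rows and columns determines the remaining column of the G-matrix. *)

Require Import Defs.
From HB Require Import structures.
From Stdlib Require ClassicalEpsilon.
From mathcomp Require Import all_boot all_order all_algebra.
From mathcomp Require Import perm finmap mpoly zify ring.

Set Implicit Arguments.
Unset Strict Implicit.
Unset Printing Implicit Defensive.

Import Order.TTheory GRing.Theory Num.Theory.
Local Open Scope ring_scope.

(** * Patterns on the regular tree *)

Lemma tree_ind n (s : tree n) (Q : tree n -> Prop) :
  Q s -> (forall t k, Q t -> Q (nbr k t)) -> forall t, Q t.
Proof.
move=> Qs QS t; rewrite -(walk_geodesic s t).
by elim: (geodesic s t) => //= k w; apply: QS.
Qed.

Lemma walk_cat n (s : tree n) u v : walk s (u ++ v) = walk (walk s v) u.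
Proof. exact: foldr_cat. Qed.

Lemma walk_rcons n (s : tree n) u k : walk s (rcons u k) = walk (nbr k s) u.
Proof. by rewrite -cats1 walk_cat. Qed.

Lemma edgeP n (s t : tree n) k :
  geodesic s (nbr k t) = k :: geodesic s t \/
  geodesic s t = k :: geodesic s (nbr k t).
Proof.
rewrite geodesic_nbr; case: (geodesic s t) => [|j w] /=; first by left.
by case: eqP => [->|_]; [right|left].
Qed.

Section TreePattern.
Variables (n : nat) (T : Type) (step : tree n -> 'I_n -> T -> T).
Hypothesis stepK : forall t k v, step (nbr k t) k (step t k v) = v.

Fixpoint along (s : tree n) (v : T) (w : seq 'I_n) : T :=
  if w is k :: w' then step (walk s w') k (along s v w') else v.

Definition pattern_from (s : tree n) (v : T) (t : tree n) : T :=
  along s v (geodesic s t).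

Lemma pattern_from_init s v : pattern_from s v s = v.
Proof. by rewrite /pattern_from geodesicss. Qed.

(** An edge towards [s] undoes the last step of the path, which is where [stepK] enters; so the
    recursion holds along every edge, in both directions. *)
Lemma pattern_from_nbr s v t k :
  pattern_from s v (nbr k t) = step t k (pattern_from s v t).
Proof.
rewrite /pattern_from.
case: (edgeP s t k) => ->; first by rewrite /= walk_geodesic.
by rewrite /= walk_geodesic -{2}(nbrK k t) stepK.
Qed.

End TreePattern.

(** * Integer matrices and mutation *)

Lemma pospartN (a : int) : pospart (- a) = pospart a - a.
Proof. by rewrite /pospart; lia. Qed.

Lemma pospart0 : pospart 0 = 0.
Proof. by []. Qed.

Definition is_sign (e : int) := e = 1 \/ e = -1.

(** Matrix mutation can be written with either sign [e]; below, [e] is chosen as the sign of a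
    column of a C-matrix. *)
Lemma sgM_pospart (e a b : int) : is_sign e ->
  Num.sg a * pospart (a * b) = a * pospart (e * b) + pospart (- (e * a)) * b.
Proof.
rewrite /pospart => he.
have [a0|a0|->] := ltgtP a 0; last by rewrite sgr0; lia.
  rewrite ltr0_sg //; have [b0|b0] := leP 0 b; case: he => ->; nia.
rewrite gtr0_sg //; have [b0|b0] := leP 0 b; case: he => ->; nia.
Qed.

Lemma sss_diag n (M : 'M[int]_n) i : sign_skew_symmetric M -> M i i = 0.
Proof.
move=> /(_ i i) [le0 eq0]; apply: (proj1 (eq0 _)).
by apply/eqP; rewrite eq_le le0 -expr2 sqr_ge0.
Qed.

Lemma sssN n (M : 'M[int]_n) : sign_skew_symmetric M -> sign_skew_symmetric (- M).
Proof.
move=> h i j; rewrite !mxE mulrNN; case: (h i j) => h1 h2.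
by split=> // /h2 [-> ->]; rewrite oppr0.
Qed.

Lemma sssT n (M : 'M[int]_n) : sign_skew_symmetric M -> sign_skew_symmetric M^T.
Proof.
move=> h i j; rewrite !mxE mulrC; case: (h i j) => h1 h2.
by split=> // /h2 [-> ->].
Qed.

Lemma mx_mutN n k (M : 'M[int]_n) : mx_mut k (- M) = - mx_mut k M.
Proof.
apply/matrixP=> i j; rewrite !mxE; case: ifP => // _.
by rewrite sgrN mulrNN mulNr -opprD.
Qed.

Lemma mx_mutT n k (M : 'M[int]_n) : mx_mut k M^T = (mx_mut k M)^T.
Proof.
apply/matrixP=> i j; rewrite !mxE orbC; case: ifP => // _; congr (_ + _).
(* Transposition exchanges the two terms of the sign form, with [e = 1] on one side and [e = -1] on
   the other. *)
rewrite (sgM_pospart _ _ (or_introl erefl)) (sgM_pospart _ _ (or_intror erefl)).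
by rewrite !mul1r !mulN1r opprK addrC mulrC [X in _ + X]mulrC.
Qed.

(** * Column signs and the elementary matrices of the C-step *)

(** This is $J_k+[eM]_+^{k\cdot}$ when [M k k = 0]. The diagonal entry is set to [-1] outright,
    which makes the matrix an involution for every [M]. *)
Definition Emx n (k : 'I_n) (e : int) (M : 'M[int]_n) : 'M[int]_n :=
  \matrix_(i, j) if i == k then (if j == k then -1 else pospart (e * M k j))
                 else (i == j)%:R.

Lemma mul_Emx m n (C : 'M_(m, n)) k e M i j :
  (C *m Emx k e M) i j =
  if j == k then - C i k else C i j + C i k * pospart (e * M k j).
Proof.
rewrite mxE (bigD1 k) //= mxE eqxx; case: eqVneq => [->|jk].
  rewrite big1 ?addr0 ?mulrN1 // => l lk.
  by rewrite mxE (negPf lk) mulr0.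
rewrite (bigD1 j) //= big1 ?addr0 => [|l /andP[lk lj]].
  by rewrite mxE (negPf jk) eqxx mulr1 addrC.
by rewrite mxE (negPf lk) (negPf lj) mulr0.
Qed.

Lemma Emx_mul m n (C : 'M_(n, m)) k e M i j :
  (Emx k e M *m C) i j =
  if i == k then - C k j + \sum_(l | l != k) pospart (e * M k l) * C l j
  else C i j.
Proof.
rewrite mxE; case: eqVneq => [->|ik].
  rewrite (bigD1 k) //= mxE !eqxx mulN1r; congr (_ + _).
  by apply: eq_bigr => l lk; rewrite mxE eqxx (negPf lk).
rewrite (bigD1 i) //= mxE (negPf ik) eqxx mul1r big1 ?addr0 // => l li.
by rewrite mxE (negPf ik) eq_sym (negPf li) mul0r.
Qed.

Lemma EmxK n k e (M : 'M[int]_n) : Emx k e M *m Emx k e M = 1%:M.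
Proof.
apply/matrixP=> i j; rewrite mul_Emx !mxE eqxx.
case: (eqVneq j k) => [->|jk]; first by case: (eqVneq i k) => //; rewrite opprK.
case: (eqVneq i k) => [->|ik]; last by rewrite mul0r addr0.
by rewrite eq_sym (negPf jk) mulN1r subrr.
Qed.

Lemma Emx_eq n k e e' (M M' : 'M[int]_n) :
  (forall j, j != k -> e * M k j = e' * M' k j) -> Emx k e M = Emx k e' M'.
Proof.
move=> h; apply/matrixP=> i j; rewrite !mxE; case: ifP => // _.
by case: ifP => // /negbT/h ->.
Qed.

(** A total function, which is the sign of the column only if that column is nonzero and
    sign-coherent. *)
Definition col_sgn n (C : 'M[int]_n) k : int :=
  if [exists i, C i k < 0] then -1 else 1.

Lemma col_sgn_is_sign n (C : 'M[int]_n) k : is_sign (col_sgn C k).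
Proof. by rewrite /col_sgn; case: ifP; [right|left]. Qed.

Lemma column_sign_uniq n (C : 'M[int]_n) k e :
  column_sign C k e -> col_sgn C k = e.
Proof.
case=> he [i Ci] h; rewrite /col_sgn; case: existsP => [[j Cj]|hn].
  by case: he => [e1|->//]; move: (h j); rewrite e1 mul1r leNgt Cj.
case: he => [->//|e1]; case: hn; exists i.
by rewrite lt_neqAle Ci -oppr_ge0 -mulN1r -e1 h.
Qed.

Lemma column_sign_col_sgn n (C : 'M[int]_n) k e :
  column_sign C k e -> column_sign C k (col_sgn C k).
Proof. by move=> h; rewrite (column_sign_uniq h). Qed.

Lemma column_sign_eq n (C C' : 'M[int]_n) k i e e' : C i k != 0 ->
  C i k = C' i k -> column_sign C k e -> column_sign C' k e' -> e = e'.
Proof.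
move=> nz eqC [he _ /(_ i) h] [he' _ /(_ i) h']; move: h h'; rewrite -eqC.
by case: he => ->; case: he' => ->; lia.
Qed.

(** The term $[-C]_+^{\cdot k}M$ vanishes for [e = 1] and is $-C^{\cdot k}M$ for [e = -1]; in both
    cases it turns $[M]_+$ into $[eM]_+$. *)
Lemma C_stepE n k (M C : 'M[int]_n) e : M k k = 0 -> column_sign C k e ->
  C_step k M C = C *m Emx k e M.
Proof.
move=> M0 [he _ hC]; apply/matrixP=> i j; rewrite mul_Emx.
rewrite !mxE (bigD1 k) //= !mxE !eqxx.
under eq_bigr => l lk do rewrite !mxE (negPf lk) addr0 mulr_natr mulrb.
rewrite [X in _ + _ + X](bigD1 k) //= !mxE eqxx [X in _ + (_ + X)]big1 ?addr0;
  last by move=> l lk; rewrite !mxE (negPf lk) mul0r.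
have -> : pospart (- C i k) = if e == 1 then 0 else - C i k.
  by case: he (hC i) => ->; rewrite /pospart /=; lia.
case: (eqVneq j k) => [->|jk].
  rewrite M0 pospart0 mulr0 !addr0 mulrN1 big1 ?addr0 // => l lk.
  by rewrite (negPf lk).
rewrite mulr0n add0r (bigD1 j) //= eqxx.
rewrite big1 ?addr0; last by move=> l /andP[_ lj]; rewrite (negPf lj).
rewrite addrAC [RHS]addrC; congr (_ + _).
by case: he => -> /=; rewrite ?mul1r ?mulN1r ?pospartN; ring.
Qed.

(** * Coherent patterns and their C-matrices *)

Lemma eq_Cmx n (M M' : tree n -> 'M[int]_n) s t :
  (forall u, M u = M' u) -> Cmx M s t = Cmx M' s t.
Proof.
by move=> h; rewrite /Cmx; elim: (geodesic s t) => //= k w ->; rewrite h.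
Qed.

Lemma trmxN n (A : 'M[int]_n) : (- A)^T = - A^T.
Proof. by apply/matrixP=> i j; rewrite !mxE. Qed.

(* The hypotheses on an exchange matrix pattern M, in a form that is invariant
   under M |-> -M and M |-> -M^T. *)
Record coherent n (M : tree n -> 'M[int]_n) : Prop := Coherent {
  coh_mut : forall t k, M (nbr k t) = mx_mut k (M t);
  coh_sss : forall t, sign_skew_symmetric (M t);
  coh_pos : forall s t k,
    same_column_sign (Cmx M s t) (Cmx (fun u => - (M u)^T) s t) k;
  coh_neg : forall s t k,
    same_column_sign (Cmx (fun u => - M u) s t) (Cmx (fun u => (M u)^T) s t) k
}.

Lemma same_column_sign_sym n (C C' : 'M[int]_n) k :
  same_column_sign C C' k -> same_column_sign C' C k.
Proof. by case=> e [h1 h2]; exists e. Qed.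

Lemma coherentN n (M : tree n -> 'M[int]_n) :
  coherent M -> coherent (fun u => - M u).
Proof.
case=> hm hs hp hn; split=> [t k|t|s t k|s t k].
- by rewrite hm mx_mutN.
- exact: sssN.
- rewrite (@eq_Cmx _ (fun u => - (- M u)^T) (fun u => (M u)^T)) //.
  by move=> u; rewrite trmxN opprK.
rewrite (@eq_Cmx _ (fun u => - - M u) M); last by move=> u; rewrite opprK.
rewrite (@eq_Cmx _ (fun u => (- M u)^T) (fun u => - (M u)^T)) //.
by move=> u; rewrite trmxN.
Qed.

Lemma coherentNT n (M : tree n -> 'M[int]_n) :
  coherent M -> coherent (fun u => - (M u)^T).
Proof.
case=> hm hs hp hn; split=> [t k|t|s t k|s t k].
- by rewrite hm mx_mutN mx_mutT.
- by apply/sssN/sssT.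
- rewrite (@eq_Cmx _ (fun u => - (- (M u)^T)^T) M).
    exact: same_column_sign_sym.
  by move=> u; rewrite trmxN opprK trmxK.
rewrite (@eq_Cmx _ (fun u => - - (M u)^T) (fun u => (M u)^T)); last first.
  by move=> u; rewrite opprK.
rewrite (@eq_Cmx _ (fun u => (- (M u)^T)^T) (fun u => - M u)).
  exact: same_column_sign_sym.
by move=> u; rewrite trmxN trmxK.
Qed.

Section CoherentPattern.
Variables (n : nat) (M : tree n -> 'M[int]_n) (cM : coherent M).
Implicit Types (s t : tree n) (k : 'I_n).

Lemma coh_diag t k : M t k k = 0.
Proof. exact/sss_diag/(coh_sss cM). Qed.

Lemma coh_row t k j : M (nbr k t) k j = - M t k j.
Proof. by rewrite (coh_mut cM) mxE eqxx. Qed.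

Lemma coh_col t k j : M (nbr k t) j k = - M t j k.
Proof. by rewrite (coh_mut cM) mxE eqxx orbT. Qed.

Lemma Cmx_sign s t k : column_sign (Cmx M s t) k (col_sgn (Cmx M s t) k).
Proof. by case: (coh_pos cM s t k) => e [/column_sign_col_sgn]. Qed.

Lemma col_sgn_dual s t k :
  col_sgn (Cmx (fun u => - (M u)^T) s t) k = col_sgn (Cmx M s t) k.
Proof.
by case: (coh_pos cM s t k) => e [/column_sign_uniq-> /column_sign_uniq->].
Qed.

(** The definition covers the edges leading away from [s]. Crossing an edge negates both the [k]-th
    row of [M] and the [k]-th column sign, so the elementary matrix is the same in both directions;
    being an involution, it also undoes the step. *)
Lemma Cmx_nbr s t k :
  Cmx M s (nbr k t) = Cmx M s t *m Emx k (col_sgn (Cmx M s t) k) (M t).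
Proof.
have away u : geodesic s (nbr k u) = k :: geodesic s u ->
    Cmx M s (nbr k u) = Cmx M s u *m Emx k (col_sgn (Cmx M s u) k) (M u).
  move=> e; rewrite Cmx_step ?e // (C_stepE _ (Cmx_sign s u k)) //.
  exact: coh_diag.
have neg u : col_sgn (Cmx M s u *m Emx k (col_sgn (Cmx M s u) k) (M u)) k
    = - col_sgn (Cmx M s u) k.
  have [he [i nz] hC] := Cmx_sign s u k; apply: column_sign_uniq; split.
  - by case: he => ->; [right|left]; rewrite ?opprK.
  - by exists i; rewrite mul_Emx eqxx oppr_eq0.
  by move=> j; rewrite mul_Emx eqxx mulrNN.
case: (edgeP s t k) => [/away //|e].
have := away (nbr k t); rewrite nbrK => /(_ e) eC.
rewrite {1}eC -mulmxA.
rewrite [X in _ = _ *m (_ *m X)](_ : _ =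
  Emx k (col_sgn (Cmx M s (nbr k t)) k) (M (nbr k t))); first by rewrite EmxK mulmx1.
by apply: Emx_eq => j jk; rewrite eC neg coh_row mulrN mulNr.
Qed.

Lemma col_sgn_nbr s t k : col_sgn (Cmx M s (nbr k t)) k = - col_sgn (Cmx M s t) k.
Proof.
have [he [i nz] hC] := Cmx_sign s t k; apply: column_sign_uniq; split.
- by case: he => ->; [right|left]; rewrite ?opprK.
- by exists i; rewrite Cmx_nbr mul_Emx eqxx oppr_eq0.
by move=> j; rewrite Cmx_nbr mul_Emx eqxx mulrNN.
Qed.

End CoherentPattern.

Lemma Cmx_nbr_dual n (M : tree n -> 'M[int]_n) (cM : coherent M) s t k :
  Cmx (fun u => - (M u)^T) s (nbr k t) =
  Cmx (fun u => - (M u)^T) s t *m Emx k (col_sgn (Cmx M s t) k) (- (M t)^T).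
Proof. by rewrite (Cmx_nbr (coherentNT cM)) (col_sgn_dual cM). Qed.

(** Since [M] and $-M^T$ have the same column sign [e], a step multiplies [M t] on both sides by
    elementary matrices of sign [e]; this is mutation in the form of [sgM_pospart]. *)
Lemma Cmx_conj n (M : tree n -> 'M[int]_n) (cM : coherent M) s t :
  (Cmx (fun u => - (M u)^T) s t)^T *m M s *m Cmx M s t = M t.
Proof.
move: t; apply: (@tree_ind _ s) => [|t k IH]; first
  by rewrite !Cmx_init trmx1 mul1mx mulmx1.
rewrite (Cmx_nbr cM) (Cmx_nbr_dual cM) trmx_mul -!mulmxA (mulmxA _ _ (Emx _ _ _)).
rewrite (mulmxA _^T (_ *m _)) (mulmxA _^T (M s)) IH (coh_mut cM).
apply/matrixP=> i j; set e := col_sgn _ _.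
rewrite -[X in _ *m X]trmxK -trmx_mul mxE mul_Emx !mxE -/e.
have M0 := coh_diag cM t k.
have E l : (M t *m Emx k e (M t)) l j =
  if j == k then - M t l k else M t l j + M t l k * pospart (e * M t k j).
  exact: mul_Emx.
move: (E i) (E k); rewrite !mxE => -> ->.
case: (eqVneq i k) => [->|ik] /=.
  by case: (eqVneq j k) => [->|jk]; rewrite M0 ?mul0r ?addr0 // oppr0.
case: (eqVneq j k) => [->|jk]; first by rewrite M0 oppr0 mul0r addr0.
rewrite M0 mul0r addr0 (sgM_pospart _ _ (col_sgn_is_sign _ _ : is_sign e)) mulrN.
by rewrite addrA (mulrC (M t k j)).
Qed.

(** * Duality of C-matrices under exchange of the two vertices *)

Notation negp M := (fun u => - M u).
Notation negtp M := (fun u => - (M u)^T).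

Lemma unit_col n (C C' : 'M[int]_n) k l : C *m C' = 1%:M ->
  (forall i, i != l -> C i k = 0) -> forall i, C' i l * C l k = (i == k)%:R.
Proof.
move=> /mulmx1C/matrixP CC h i; move: (CC i k); rewrite !mxE => <-.
by rewrite (bigD1 l) //= big1 ?addr0 // => j jl; rewrite h ?mulr0.
Qed.

(** The only nonzero entry of the column is invertible over the integers, hence [1] or [-1]. *)
Lemma unit_col_sign n (C C' : 'M[int]_n) k l e : C *m C' = 1%:M ->
  column_sign C k e -> (forall i, i != l -> C i k = 0) ->
  C l k = e /\ C' k l = e.
Proof.
move=> CC [he _ /(_ l) h] h0; have := unit_col CC h0 k; rewrite eqxx.
move: (C l k) (C' k l) h => a b h ab.
have /eqP : (`|b| * `|a|)%N = 1%N by rewrite -abszM ab.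
rewrite muln_eq1 => /andP[/eqP hb /eqP ha].
by case: he h => -> h; move: ab; split; nia.
Qed.

(** Duality turns a move of the base vertex into a step of the pattern [- M] whose base is [t]. *)
Lemma base_change n (M : tree n -> 'M[int]_n) (cM : coherent M) s t l :
  Cmx M s t *m Cmx (negp M) t s = 1%:M ->
  Cmx M (nbr l s) t *m Cmx (negp M) t (nbr l s) = 1%:M ->
  Cmx M (nbr l s) t =
    Emx l (col_sgn (Cmx (negp M) t s) l) (- M s) *m Cmx M s t.
Proof.
move=> H1 H3; rewrite (Cmx_nbr (coherentN cM)) mulmxA in H3.
set E := Emx _ _ _ in H3 *.
have H4 : Cmx M (nbr l s) t *m Cmx (negp M) t s = E.
  by rewrite -[LHS]mulmx1 -(EmxK l (col_sgn (Cmx (negp M) t s) l) (- M s))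
    mulmxA H3 mul1mx.
by rewrite -H4 -mulmxA (mulmx1C H1) mulmx1.
Qed.

Section DualitySquare.
Variables (n : nat) (M : tree n -> 'M[int]_n) (cM : coherent M).
Variables (s t : tree n) (k l : 'I_n).
Let N := negtp M.
Let cN : coherent N := coherentNT cM.
Hypothesis H1 : Cmx M s t *m Cmx (negp M) t s = 1%:M.
Hypothesis H2 : Cmx M s (nbr k t) *m Cmx (negp M) (nbr k t) s = 1%:M.
Hypothesis H3 : Cmx M (nbr l s) t *m Cmx (negp M) t (nbr l s) = 1%:M.
Hypothesis D1 : Cmx N s t *m Cmx (negp N) t s = 1%:M.
Hypothesis D3 : Cmx N (nbr l s) t *m Cmx (negp N) t (nbr l s) = 1%:M.

Let C := Cmx M s t.
Let C' := Cmx (negp M) t s.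
Let eta := col_sgn C k.
Let eta' := col_sgn (Cmx M (nbr l s) t) k.
Let eps := col_sgn C' l.
Let eps' := col_sgn (Cmx (negp M) (nbr k t) s) l.

Let back_step : Cmx (negp M) (nbr k t) s = Emx k eta (M t) *m C'.
Proof.
have := H2; rewrite (Cmx_nbr cM) -/C -/eta => H.
have {}H : C' *m (C *m Emx k eta (M t) *m Cmx (negp M) (nbr k t) s) = C'.
  by rewrite H mulmx1.
rewrite !mulmxA (mulmx1C H1) mul1mx in H.
by rewrite -{}H mulmxA EmxK mul1mx.
Qed.

(** If column [k] of [C] has a nonzero entry outside row [l], each sign is unchanged by crossing the
    opposite edge. Otherwise that column is [eta] times a unit vector, both signs flip, and the two
    resulting errors compensate because row [k] of [M t] is determined by row [l] of [M s *m C]. *)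
Lemma duality_square :
  Cmx M (nbr l s) (nbr k t) *m Cmx (negp M) (nbr k t) (nbr l s) = 1%:M.
Proof.
rewrite (Cmx_nbr cM) (Cmx_nbr (coherentN cM)) -/eta' -/eps' back_step.
have bc := base_change cM H1 H3; rewrite -/C -/C' -/eps in bc.
have sC := Cmx_sign cM s t k; rewrite -/C -/eta in sC.
have sC2 := Cmx_sign cM (nbr l s) t k; rewrite -/eta' bc in sC2.
have sC' := Cmx_sign (coherentN cM) t s l; rewrite -/C' -/eps in sC'.
have sC2' := Cmx_sign (coherentN cM) (nbr k t) s l.
rewrite -/eps' back_step in sC2'.
rewrite bc.
(* With the two signs exchanged, the product telescopes through [EmxK] and [H1]. *)
suff hE : Emx l eps (- M s) *m C *m Emx k eta' (M t) =
          Emx l eps' (- M s) *m C *m Emx k eta (M t).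
  rewrite hE !mulmxA -(mulmxA _ (Emx k _ _) (Emx k _ _)) EmxK mulmx1.
  by rewrite -(mulmxA _ C) H1 mulmx1 EmxK.
have [/existsP[i /andP[il nz]]|] := boolP [exists i, (i != l) && (C i k != 0)].
  have <- : eta = eta'.
    apply: column_sign_eq nz _ sC sC2.
    by rewrite Emx_mul (negPf il).
  suff -> : eps = eps' by [].
  have [/existsP[j /andP[jk nz']]|] := boolP [exists j, (j != k) && (C' j l != 0)].
    by apply: column_sign_eq nz' _ sC' sC2'; rewrite Emx_mul (negPf jk).
  rewrite negb_exists => /forallP h; case/eqP: nz.
  have h' j : j != k -> C' j l = 0.
    by move=> jk; apply/eqP; have := h j; rewrite jk negbK.
  have := unit_col (mulmx1C H1 : C' *m C = 1%:M) h' i.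
  rewrite (negPf il) => /eqP; rewrite mulf_eq0 => /orP[/eqP//|/eqP z].
  have := unit_col (mulmx1C H1 : C' *m C = 1%:M) h' l.
  by rewrite z mulr0 eqxx.
rewrite negb_exists => /forallP h.
have h' i : i != l -> C i k = 0.
  by move=> il; apply/eqP; have := h i; rewrite il negbK.
have seta : is_sign eta by exact: col_sgn_is_sign.
have [Clk C'kl] := unit_col_sign H1 sC h'.
have epsE : eps = eta.
  case: (sC') => he _ /(_ k); rewrite C'kl.
  by case: he => ->; case: seta => ->; lia.
(* The change of base negates the only nonzero entry of the column, which flips [eta']; the same
   happens to [eps'] from the other side. *)
have EC e : (Emx l e (- M s) *m C) l k = - eta.
  by rewrite Emx_mul eqxx Clk big1 ?addr0 // => i il; rewrite h' ?mulr0.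
have eta'E : eta' = - eta.
  case: (sC2) => he _ /(_ l); rewrite EC.
  by case: he => ->; case: seta => ->; lia.
have eps'E : eps' = - eta.
  case: (sC2') => he _ /(_ k); rewrite Emx_mul eqxx C'kl big1 ?addr0.
    by case: he => ->; case: seta => ->; lia.
  move=> i ik; suff -> : C' i l = 0 by rewrite mulr0.
  have /eqP := unit_col H1 h' i; rewrite (negPf ik) mulf_eq0 => /orP[/eqP//|].
  by rewrite Clk; case: seta => ->.
(* By sign equality at s and at its neighbour, the k-th column of the dual
   C-matrix changes sign with the base vertex too, so it is eta e_l as well. *)
have sD := Cmx_sign cN s t k; have sD2 := Cmx_sign cN (nbr l s) t k.
have D0 i : i != l -> Cmx N s t i k = 0.
  move=> il; apply/eqP; apply: contraT => nz.
  have bcN := base_change cN D1 D3.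
  have : col_sgn (Cmx N s t) k = col_sgn (Cmx N (nbr l s) t) k.
    by apply: column_sign_eq nz _ sD sD2; rewrite bcN Emx_mul (negPf il).
  rewrite !(col_sgn_dual cM) -/C -/eta -/eta' eta'E.
  by case: seta => ->.
have [Dlk _] := unit_col_sign D1 sD D0.
rewrite (col_sgn_dual cM) -/C -/eta in Dlk.
(* In [Cmx_conj] the dual column [k] selects row [l]. *)
have rowE j : M t k j = eta * (M s *m C) l j.
  rewrite -(Cmx_conj cM s t) -mulmxA -/C mxE (bigD1 l) //= mxE Dlk big1 ?addr0 //.
  by move=> i il; rewrite mxE D0 ?mul0r.
apply/matrixP=> i j; rewrite !mul_Emx.
have [->|il] := eqVneq i l; last first.
  by rewrite !Emx_mul (negPf il) h' ?mul0r ?addr0.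
rewrite !EC; case: (eqVneq j k) => // jk.
rewrite !Emx_mul eqxx epsE eta'E eps'E rowE.
have -> : (M s *m C) l j = \sum_(m | m != l) M s l m * C m j.
  by rewrite mxE (bigD1 l) //= (coh_diag cM) mul0r add0r.
set S := \sum_(m | m != l) M s l m * C m j.
have -> : \sum_(m | m != l) pospart (- eta * (- M s) l m) * C m j =
    \sum_(m | m != l) pospart (eta * (- M s) l m) * C m j + eta * S.
  rewrite mulr_sumr -big_split /=; apply: eq_bigr => m _.
  by rewrite mulNr pospartN !mxE; ring.
by rewrite (mulNr eta (eta * S)) pospartN; case: seta => ->; ring.
Qed.

End DualitySquare.

(** Induction on the length of a word joining the vertices: removing the first or the last letter,
    or both, gives the other three corners of the square. [M] varies in the induction, since the
    square also uses duality for $-M^T$. *)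
Lemma Cmx_duality n (M : tree n -> 'M[int]_n) s t : coherent M ->
  Cmx M s t *m Cmx (negp M) t s = 1%:M.
Proof.
rewrite -(walk_geodesic s t); move: (geodesic s t) => w cM.
have [m] := ubnP (size w); elim: m => // m IH in M s w cM *.
case: w => [_|k w]; first by rewrite /= !Cmx_init mulmx1.
case/lastP: w => [_|u l] /=.
  rewrite (Cmx_nbr cM) Cmx_init mul1mx.
  have := Cmx_nbr (coherentN cM) (nbr k s) (nbr k s) k.
  rewrite nbrK Cmx_init mul1mx => ->; set E := Emx _ _ _.
  suff -> : E = Emx k (col_sgn 1%:M k) (- M (nbr k s)) by rewrite EmxK.
  by apply: Emx_eq => j jk; rewrite mxE (coh_row cM) opprK.
rewrite ltnS size_rcons => szu.
rewrite walk_rcons -{1 4}(nbrK l s).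
have sz (v : seq 'I_n) : (size v <= (size u).+1)%N -> (size v < m)%N.
  by move=> h; apply: leq_ltn_trans h _.
apply: duality_square => //.
- by apply: IH => //; apply: sz.
- by have := IH M (nbr l s) (k :: u) cM (sz (k :: u) (leqnn _)).
- by have := IH M s (rcons u l) cM; rewrite walk_rcons nbrK size_rcons; apply.
- by apply: IH => //; [apply: coherentNT|apply: sz].
- have := IH _ s (rcons u l) (coherentNT cM).
  by rewrite walk_rcons nbrK size_rcons; apply.
Qed.

Lemma Cmx_base n (M : tree n -> 'M[int]_n) (cM : coherent M) s t l :
  Cmx M (nbr l s) t =
    Emx l (col_sgn (Cmx (negp M) t s) l) (- M s) *m Cmx M s t.
Proof. by apply: base_change => //; apply: Cmx_duality. Qed.

(** * G-matrices *)

(* By the dualities, this is the inverse transpose of the C-matrix of the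
   pattern - M^T. *)
Definition Gmx n (M : tree n -> 'M[int]_n) (s t : tree n) : 'M[int]_n :=
  (Cmx (fun u => (M u)^T) t s)^T.

Section Gmatrix.
Variables (n : nat) (M : tree n -> 'M[int]_n) (cM : coherent M).

Lemma Cmx_dual_Gmx s t : Cmx (negtp M) s t *m (Gmx M s t)^T = 1%:M.
Proof.
rewrite /Gmx trmxK (@eq_Cmx _ (fun u => (M u)^T) (negp (negtp M))).
  exact/Cmx_duality/coherentNT.
by move=> u; rewrite opprK.
Qed.

Lemma Gmx_init s : Gmx M s s = 1%:M.
Proof. by rewrite /Gmx Cmx_init trmx1. Qed.

(** The recursion of g-vectors, obtained by inverting the C-step of $-M^T$; the sign is that of [M]
    by [col_sgn_dual]. *)
Lemma Gmx_nbr s t k l i : Gmx M s (nbr k t) l i =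
  if i == k then - Gmx M s t l k
    + \sum_j Gmx M s t l j * pospart (- (col_sgn (Cmx M s t) k * M t j k))
  else Gmx M s t l i.
Proof.
have H := Cmx_dual_Gmx s (nbr k t); rewrite (Cmx_nbr_dual cM) in H.
set E := Emx _ _ _ in H.
have {H} E1 : (Gmx M s (nbr k t))^T = E *m (Gmx M s t)^T.
  rewrite -[LHS]mul1mx -(EmxK k (col_sgn (Cmx M s t) k) (- (M t)^T)) -/E -mulmxA.
  congr (_ *m _); rewrite -[LHS]mul1mx -(mulmx1C (Cmx_dual_Gmx s t)) -mulmxA.
  by rewrite (mulmxA _ E) H mulmx1.
have := congr1 (fun A : 'M_n => A i l) E1; rewrite /= mxE => ->.
rewrite Emx_mul; case: eqVneq => _; rewrite !mxE //; congr (_ + _).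
rewrite [RHS](bigD1 k) //= (coh_diag cM) mulr0 oppr0 pospart0 mulr0 add0r.
by apply: eq_bigr => j _; rewrite !mxE mulrC mulrN.
Qed.

(** The transposed factor in [Cmx_conj] is the inverse of the G-matrix. *)
Lemma Gmx_mul s t : Gmx M s t *m M t = M s *m Cmx M s t.
Proof.
have H : Gmx M s t *m (Cmx (negtp M) s t)^T = 1%:M.
  by rewrite -[Gmx M s t]trmxK -trmx_mul Cmx_dual_Gmx trmx1.
by rewrite -[in LHS](Cmx_conj cM s t) !mulmxA H mul1mx.
Qed.

End Gmatrix.

(** * A decision procedure for identities in abelian groups *)

Inductive zexp := ZVar of nat | ZZero | ZAdd of zexp & zexp | ZOpp of zexp.

Fixpoint zeval (V : zmodType) (env : seq V) (e : zexp) : V :=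
  match e with
  | ZVar i => env`_i
  | ZZero => 0
  | ZAdd a b => zeval env a + zeval env b
  | ZOpp a => - zeval env a
  end.

Fixpoint zcoef (e : zexp) (i : nat) : int :=
  match e with
  | ZVar j => if i == j then 1 else 0
  | ZZero => 0
  | ZAdd a b => zcoef a i + zcoef b i
  | ZOpp a => - zcoef a i
  end.

Lemma zevalE (V : zmodType) (env : seq V) e :
  zeval env e = \sum_(i < size env) env`_i *~ zcoef e i.
Proof.
elim: e => [j||a IHa b IHb|a IHa] /=.
- have [lt_j|ge_j] := ltnP j (size env); last first.
    rewrite nth_default // big1 // => i _.
    by rewrite ltn_eqF ?mulr0z // (leq_trans (ltn_ord i)).
  rewrite (bigD1 (Ordinal lt_j)) //= eqxx mulr1z big1 ?addr0 // => i.
  by rewrite -val_eqE /= => /negPf ->; rewrite mulr0z.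
- by rewrite big1 // => i _; rewrite mulr0z.
- by rewrite IHa IHb -big_split; apply: eq_bigr => i _; rewrite mulrzDr.
- by rewrite IHa -sumrN; apply: eq_bigr => i _; rewrite mulrNz.
Qed.

(** An index beyond the end of [env] evaluates to the default [0], so a boolean test of finitely
    many coefficients decides the identity. *)
Lemma zexp_eq (V : zmodType) (env : seq V) a b :
  all (fun i => zcoef a i == zcoef b i) (iota 0 (size env)) ->
  zeval env a = zeval env b.
Proof.
move=> /allP h; rewrite !zevalE; apply: eq_bigr => i _; congr (_ *~ _).
by apply/eqP/h; rewrite mem_iota ltn_ord.
Qed.

Ltac zmem x l := lazymatch l with
  | nil => constr:(false)
  | ?z :: ?l' => match goal with
    | _ => let __ := lazymatch goal with _ => unify x z end in constr:(true)
    | _ => zmem x l' end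
  end.
Ltac zvars l e := lazymatch e with
  | (?a + ?b)%R => let l1 := zvars l a in zvars l1 b
  | (- ?a)%R => zvars l a
  | 0%R => l
  | _ => lazymatch zmem e l with true => l | false => constr:(e :: l) end
  end.
Ltac zindex x l := lazymatch l with
  | ?z :: ?l' => match goal with
    | _ => let __ := lazymatch goal with _ => unify x z end in constr:(0%N)
    | _ => let k := zindex x l' in constr:(S k) end
  end.
Ltac zreify l e := lazymatch e with
  | (?a + ?b)%R => let u := zreify l a in let v := zreify l b in constr:(ZAdd u v)
  | (- ?a)%R => let u := zreify l a in constr:(ZOpp u)
  | 0%R => constr:(ZZero)
  | _ => let k := zindex e l in constr:(ZVar k)
  end.
Ltac zmod := lazymatch goal with
  | |- @eq ?V ?a ?b =>
    let l0 := zvars (@nil V) a in let l := zvars l0 b in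
    let u := zreify l a in let v := zreify l b in
    exact (@zexp_eq _ l u v isT)
  end.

(** * Semifields in additive notation *)

(* The multiplicative group of the semifield is written additively, so that
   exponents become integer multiples. *)
HB.mixin Record Zmodule_isAddSemifield V of GRing.Zmodule V := {
  oadd : V -> V -> V;
  oaddA : associative oadd;
  oaddC : commutative oadd;
  addr_oaddr : forall x y z : V, x + oadd y z = oadd (x + y) (x + z)
}.

#[short(type="sfType")]
HB.structure Definition AddSemifield :=
  {V of Zmodule_isAddSemifield V & GRing.Zmodule V}.

Lemma addz_minr (x y z : int) : x + Num.min y z = Num.min (x + y) (x + z).
Proof. exact: addr_minr. Qed.

(** The tropical semifield of integers, in which valuations take their values. *)
HB.instance Definition _ :=
  Zmodule_isAddSemifield.Build int (@minA _ int) (@minC _ int) addz_minr.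

Section SemifieldTheory.
Variable V : sfType.
Implicit Types x y : V.

Lemma oaddN0 x : oadd (- x) 0 = oadd x 0 - x.
Proof. by rewrite addrC addr_oaddr addr0 addNr oaddC. Qed.

(** Multiplicatively, $1+x^{-1}=x^{-1}(1+x)$: a change of sign costs a monomial. *)
Lemma oadd_sign e e' x : is_sign e -> is_sign e' -> oadd (x *~ e') 0 =
  oadd (x *~ e) 0 + x *~ (if e == e' then 0 else - e).
Proof.
case=> -> [] -> /=; rewrite ?mulr0z ?addr0 // ?opprK ?mulrN1z ?mulr1z ?oaddN0 //.
by zmod.
Qed.

End SemifieldTheory.

(** * The dynamics of coefficients and F-polynomials *)

Section Dynamics.
Variables (n : nat) (V : sfType).
Implicit Types (A : 'M[int]_n) (y F : {ffun 'I_n -> V}).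

Definition ymut k A y : {ffun 'I_n -> V} := [ffun j =>
  if j == k then - y k
  else y j + y k *~ pospart (A k j) - oadd (y k) 0 *~ A k j].

(** The exchange relation of F-polynomials. With $Y_k=y^{c_k}\prod_jF_j^{b_{jk}}$ and [e] the sign
    of $c_k$, its two products combine into $\prod_jF_j^{[-eb_{jk}]_+}(Y_k^e\oplus1)$. *)
Definition fmut k A (e : int) y F : {ffun 'I_n -> V} := [ffun i =>
  if i == k then - F k + \sum_j F j *~ pospart (- (e * A j k))
                 + oadd (y k *~ e) 0
  else F i].

Variable M : tree n -> 'M[int]_n.

Definition Ypat s y := pattern_from (fun t k => ymut k (M t)) s y.

(** The value at [y] of the F-polynomials, directly in the semifield [V]; the initial [0] stands for
    the constant polynomial 1. *)
Definition Fpat s y := pattern_from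
  (fun t k => fmut k (M t) (col_sgn (Cmx M s t) k) (Ypat s y t)) s 0.

End Dynamics.

Section DynamicsTheory.
Variables (n : nat) (V : sfType) (M : tree n -> 'M[int]_n).
Hypothesis cM : coherent M.
Implicit Types (y F : {ffun 'I_n -> V}).

Lemma ymutK t k y : ymut k (M (nbr k t)) (ymut k (M t) y) = y.
Proof.
apply/ffunP=> j; rewrite !ffunE eqxx; case: eqVneq => [->|jk].
  by rewrite opprK.
rewrite (coh_row cM) pospartN oaddN0 !mulrzBl !mulNrz !mulrNz mulrzBr.
by zmod.
Qed.

Lemma Ypat_init s y : Ypat M s y s = y.
Proof. exact: pattern_from_init. Qed.

Lemma Ypat_nbr s y t k : Ypat M s y (nbr k t) = ymut k (M t) (Ypat M s y t).
Proof. by rewrite /Ypat pattern_from_nbr //; apply: ymutK. Qed.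

Lemma Ypat_trans s y t u : Ypat M t (Ypat M s y t) u = Ypat M s y u.
Proof.
move: u; apply: (@tree_ind _ t) => [|u k IH]; first exact: Ypat_init.
by rewrite !Ypat_nbr IH.
Qed.

Lemma Fpat_init s y : Fpat M s y s = 0.
Proof. exact: pattern_from_init. Qed.

(** The step is reversible because the column sign, [Y_k] and the [k]-th column of [M] all change
    sign across the edge. *)
Lemma Fpat_nbr s y t k : Fpat M s y (nbr k t) =
  fmut k (M t) (col_sgn (Cmx M s t) k) (Ypat M s y t) (Fpat M s y t).
Proof.
rewrite /Fpat pattern_from_nbr // => {}t {}k F.
apply/ffunP=> i; rewrite !ffunE eqxx; case: eqVneq => [->|//].
have Yk : Ypat M s y (nbr k t) k = - Ypat M s y t k.
  by rewrite Ypat_nbr ffunE eqxx.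
rewrite (col_sgn_nbr cM) Yk mulNrz mulrNz opprK.
set e := col_sgn _ _; set S := \sum_j _; set S' := \sum_j _.
suff -> : S' = S by zmod.
apply: eq_bigr => j _; rewrite !ffunE (coh_col cM) mulrNN.
by case: eqVneq => // ->; rewrite (coh_diag cM) mulr0 oppr0 pospart0 !mulr0z.
Qed.

(** The separation formula for coefficients. The C-step, the F-step and the mutation of [M] are all
    written with the same column sign, after which the terms match. *)
Lemma Ypat_Fpat s y t j : Ypat M s y t j =
  \sum_i y i *~ Cmx M s t i j + \sum_i Fpat M s y t i *~ M t i j.
Proof.
move: t j; apply: (@tree_ind _ s) => [j|t k IH j].
  rewrite Ypat_init Cmx_init Fpat_init (bigD1 j) //= mxE eqxx mulr1z.
  rewrite !big1 ?addr0 // => i; first by rewrite ffunE mul0rz.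
  by move=> ij; rewrite mxE (negPf ij) mulr0z.
rewrite Ypat_nbr Fpat_nbr (Cmx_nbr cM) (coh_mut cM) ffunE.
have he := col_sgn_is_sign (Cmx M s t) k; set e := col_sgn _ _ in he *.
set F := Fpat M s y t in IH *; set Y := Ypat M s y t in IH *.
case: eqVneq => [->|jk].
  rewrite (IH k) opprD -!sumrN; congr (_ + _); apply: eq_bigr => i _.
    by rewrite mul_Emx eqxx mulrNz.
  rewrite mxE eqxx orbT ffunE mulrNz; case: eqVneq => // ->.
  by rewrite (coh_diag cM) !mulr0z.
have -> : \sum_i y i *~ (Cmx M s t *m Emx k e (M t)) i j =
    \sum_i y i *~ Cmx M s t i j
      + (\sum_i y i *~ Cmx M s t i k) *~ pospart (e * M t k j).
  rewrite mulrz_suml -big_split; apply: eq_bigr => i _ /=.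
  by rewrite mul_Emx (negPf jk) mulrzDr mulrzA.
have -> : \sum_i fmut k (M t) e Y F i *~ mx_mut k (M t) i j =
    \sum_i F i *~ M t i j - oadd (Y k *~ e) 0 *~ M t k j
      + (\sum_i F i *~ M t i k) *~ pospart (e * M t k j).
  rewrite (bigD1 k) //= ffunE eqxx mxE eqxx.
  under eq_bigr => i ik.
    rewrite ffunE mxE (negPf ik) (negPf jk) /= (sgM_pospart _ _ he) !mulrzDr.
    over.
  rewrite !big_split /= [X in _ = X - _ + _](bigD1 k) //=.
  rewrite [X in _ = _ - _ + X *~ _](bigD1 k) //= (coh_diag cM) mulr0z add0r.
  rewrite [X in (- F k + X + _) *~ _](bigD1 k) //= (coh_diag cM) mulr0 oppr0.
  rewrite pospart0 mulr0z add0r mulrNz !mulrzDl mulNrz !mulrz_suml.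
  under [X in _ + (_ + (X + _)) = _]eq_bigr do rewrite mulrzA.
  under [X in _ + (_ + (_ + X)) = _]eq_bigr do rewrite mulrzA.
  by zmod.
have -> : Y k *~ pospart (M t k j) =
  Y k *~ pospart (e * M t k j) + (Y k *~ (if 1 == e then 0 else -1)) *~ - M t k j.
  rewrite -mulrzA -mulrzDr; congr (_ *~ _).
  by case: he => -> /=; rewrite ?mul1r ?mulN1r ?pospartN; ring.
rewrite (oadd_sign _ (or_introl erefl) he) mulr1z.
rewrite (mulrzDl (M t k j)) (IH j) {1}(IH k) (mulrzDl (pospart _)) mulrNz.
by zmod.
Qed.

End DynamicsTheory.

(** * Compatibility of the recursions with semifield morphisms *)

Section Naturality.
Variables (n : nat) (V V' : sfType) (M : tree n -> 'M[int]_n).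
Hypothesis cM : coherent M.
Variables (h : {additive V -> V'}) (h_oadd : {morph h : x y / oadd x y}).

Lemma Ypat_morph s (y : {ffun 'I_n -> V}) t j :
  h (Ypat M s y t j) = Ypat M s [ffun i => h (y i)] t j.
Proof.
move: t j; apply: (@tree_ind _ s) => [j|t k IH j].
  by rewrite !Ypat_init ffunE.
rewrite !Ypat_nbr // !ffunE -!IH; case: ifP => _; first by rewrite raddfN.
by rewrite raddfB raddfD /= !raddfMz h_oadd raddf0.
Qed.

Lemma Fpat_morph s (y : {ffun 'I_n -> V}) t j :
  h (Fpat M s y t j) = Fpat M s [ffun i => h (y i)] t j.
Proof.
move: t j; apply: (@tree_ind _ s) => [j|t k IH j].
  by rewrite !Fpat_init !ffunE raddf0.
rewrite !Fpat_nbr // !ffunE -!IH; case: ifP => _ //.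
rewrite !raddfD raddfN h_oadd raddfMz raddf0 Ypat_morph raddf_sum.
by congr (_ + _ + _); apply: eq_bigr => i _; rewrite raddfMz IH.
Qed.

End Naturality.

(** * Change of sign and of base vertex for F-polynomials *)

Section FpatTheory.
Variables (n : nat) (M : tree n -> 'M[int]_n).
Hypothesis cM : coherent M.

Lemma Fpat_nbr_neq (V : sfType) s (y : {ffun 'I_n -> V}) t k i : i != k ->
  Fpat M s y (nbr k t) i = Fpat M s y t i.
Proof. by move=> ik; rewrite Fpat_nbr // ffunE (negPf ik). Qed.

(* Replacing the tropical sign by another sign costs a monomial in the initial
   coefficients. *)
Lemma Fpat_nbr_sign s t k e : is_sign e -> exists h : 'I_n -> int,
  forall (V : sfType) (y : {ffun 'I_n -> V}),
  Fpat M s y (nbr k t) k = \sum_m y m *~ h m + (- Fpat M s y t k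
    + \sum_j Fpat M s y t j *~ pospart (- (e * M t j k))
    + oadd (Ypat M s y t k *~ e) 0).
Proof.
move=> he; have hC := col_sgn_is_sign (Cmx M s t) k.
set c := col_sgn _ _ in hC; pose d := if e == c then 0 else - e.
exists (fun m => Cmx M s t m k * d) => V y.
rewrite Fpat_nbr // ffunE eqxx -/c (oadd_sign _ he hC) -/d Ypat_Fpat //.
under [X in _ = X + _]eq_bigr do rewrite mulrzA.
rewrite -mulrz_suml (mulrzDl d).
have -> : \sum_j Fpat M s y t j *~ pospart (- (e * M t j k)) =
    \sum_j Fpat M s y t j *~ pospart (- (c * M t j k))
    + (\sum_i Fpat M s y t i *~ M t i k) *~ d.
  rewrite mulrz_suml -big_split; apply: eq_bigr => j _ /=.
  rewrite -mulrzA -mulrzDr; congr (_ *~ _); rewrite /d.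
  by case: he => ->; case: hC => ->; rewrite /= ?mul1r ?mulN1r ?opprK ?pospartN; ring.
by zmod.
Qed.

(** Multiplicatively, $F^{s}_{i;u}(y)=y^{h_i}\prod_lF^{s}_{l;t}(y)^{g_{li}}\,F^{t}_{i;u}(Y_t)$ with
    the g-vectors based at [t]. The exponents [h] are the same for all semifields and all [y]. *)
Lemma Fpat_base s t u : exists h : 'I_n -> 'I_n -> int,
  forall (V : sfType) (y : {ffun 'I_n -> V}) i,
  Fpat M s y u i = \sum_m y m *~ h m i
    + \sum_l Fpat M s y t l *~ Gmx M t u l i
    + Fpat M t (Ypat M s y t) u i.
Proof.
move: u; apply: (@tree_ind _ t) => [|u k [h IH]].
  exists (fun _ _ => 0) => V y i; rewrite Gmx_init Fpat_init ffunE addr0.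
  rewrite [X in X + _]big1 ?add0r => [|m _]; last by rewrite mulr0z.
  rewrite (bigD1 i) //= mxE eqxx mulr1z big1 ?addr0 // => l li.
  by rewrite mxE (negPf li) mulr0z.
(* The sign relative to the base [t]; it may differ from the one relative to [s], and the monomial
   this costs goes into [h]. *)
set e := col_sgn (Cmx M t u) k; have he : is_sign e by exact: col_sgn_is_sign.
have [h' h'E] := Fpat_nbr_sign s u k he.
pose c j := pospart (- (e * M u j k)).
exists (fun m i => if i == k then h' m - h m k + \sum_j h m j * c j else h m i).
move=> V y i; rewrite [in X in _ = _ + X]Fpat_nbr // -/e ffunE.
under [X in _ = _ + X + _]eq_bigr => l _ do rewrite (Gmx_nbr cM) -/e.
case: (eqVneq i k) => [->|ik]; last by rewrite Fpat_nbr_neq // IH.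
rewrite h'E Ypat_trans // IH.
have -> : \sum_j Fpat M s y u j *~ pospart (- (e * M u j k)) =
    \sum_m y m *~ (\sum_j h m j * c j)
    + \sum_l Fpat M s y t l *~ (\sum_j Gmx M t u l j * c j)
    + \sum_j Fpat M t (Ypat M s y t) u j *~ c j.
  under eq_bigr do rewrite IH !mulrzDl.
  rewrite !big_split /=; congr (_ + _ + _).
    under eq_bigr do rewrite mulrz_suml.
    rewrite exchange_big /=; apply: eq_bigr => m _.
    by rewrite mulrz_sumr; apply: eq_bigr => j _; rewrite mulrzA.
  under eq_bigr do rewrite mulrz_suml.
  rewrite exchange_big /=; apply: eq_bigr => m _.
  by rewrite mulrz_sumr; apply: eq_bigr => j _; rewrite mulrzA.
under [X in _ = X + _ + _]eq_bigr do rewrite !mulrzDr mulrNz.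
under [X in _ = _ + X + _]eq_bigr do rewrite mulrzDr mulrNz.
rewrite !big_split /= !sumrN.
by zmod.
Qed.

End FpatTheory.

(** * The semifield of positive elements of a field *)

(* Sums over lists count multiplicities, so [me_indep] is linear independence
   over the integers. *)
Record mono_emb := MonoEmb {
  meG : zmodType;
  meK : fieldType;
  me : meG -> meK;
  me0 : me 0 = 1;
  meD : forall g h, me (g + h) = me g * me h;
  me_indep : forall l l' : seq meG,
    \sum_(g <- l) me g = \sum_(g <- l') me g -> perm_eq l l'
}.

Section MonomialSums.
Variable E : mono_emb.
Implicit Types l : seq (meG E).

Definition msum l : meK E := \sum_(g <- l) me g.

Definition lprod l l' : seq (meG E) := [seq g + h | g <- l, h <- l'].

Lemma msum_cat l l' : msum (l ++ l') = msum l + msum l'.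
Proof. exact: big_cat. Qed.

Lemma msum1 g : msum [:: g] = me g.
Proof. exact: big_seq1. Qed.

Lemma msum_lprod l l' : msum (lprod l l') = msum l * msum l'.
Proof.
rewrite /msum /lprod big_allpairs_dep mulr_suml; apply: eq_bigr => g _.
by rewrite mulr_sumr; apply: eq_bigr => h _; rewrite meD.
Qed.

Lemma msum_neq0 l : l != [::] -> msum l != 0.
Proof.
apply: contraNneq => h0; have /perm_nilP -> // : perm_eq l [::].
by apply: me_indep; rewrite big_nil.
Qed.

Lemma me_neq0 g : me g != 0 :> meK E.
Proof. by rewrite -msum1 msum_neq0. Qed.

Lemma cat_neq_nil l l' : l != [::] -> l ++ l' != [::].
Proof. by case: l. Qed.

Lemma lprod_neq_nil l l' : l != [::] -> l' != [::] -> lprod l l' != [::].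
Proof. by case: l => // g l; case: l'. Qed.

Definition positive (z : meK E) : Prop :=
  exists l l', [/\ l != [::], l' != [::] & z = msum l / msum l'].

(** A boolean predicate, so that positive elements form a subtype on which the value is
    injective. *)
Definition positiveb (z : meK E) : bool :=
  if ClassicalEpsilon.excluded_middle_informative (positive z) then true else false.

Lemma positiveP z : reflect (positive z) (positiveb z).
Proof.
rewrite /positiveb.
by case: ClassicalEpsilon.excluded_middle_informative => h; constructor.
Qed.

Lemma positive_me g : positive (me g).
Proof. by exists [:: g], [:: 0]; split; rewrite ?msum1 ?me0 ?divr1. Qed.

Lemma positiveM z z' : positive z -> positive z' -> positive (z * z').
Proof.
case=> a [b [a0 b0 ->]] [c [d [c0 d0 ->]]].
exists (lprod a c), (lprod b d); split; rewrite ?lprod_neq_nil //.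
by rewrite !msum_lprod mulf_div.
Qed.

Lemma positiveV z : positive z -> positive z^-1.
Proof. by case=> a [b [a0 b0 ->]]; exists b, a; split; rewrite ?invf_div. Qed.

Lemma positiveD z z' : positive z -> positive z' -> positive (z + z').
Proof.
case=> a [b [a0 b0 ->]] [c [d [c0 d0 ->]]].
exists (lprod a d ++ lprod c b), (lprod b d).
split; rewrite ?cat_neq_nil ?lprod_neq_nil //.
by rewrite msum_cat !msum_lprod addf_div ?msum_neq0.
Qed.

Lemma positive_neq0 z : positive z -> z != 0.
Proof. by case=> a [b [a0 b0 ->]]; rewrite mulf_neq0 ?invr_eq0 ?msum_neq0. Qed.

Definition posT : Type := {z : meK E | positiveb z}.

HB.instance Definition _ := Choice.copy posT {z : meK E | positiveb z}.

Definition fval (x : posT) : meK E := sval x.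

Lemma fval_inj : injective fval.
Proof. exact: val_inj. Qed.

Lemma fvalP x : positive (fval x).
Proof. exact/positiveP/(svalP x). Qed.

Definition toPos z (h : positive z) : posT := exist _ z (introT (positiveP z) h).

Definition mono g := toPos (positive_me g).
Definition pos_add x y := toPos (positiveM (fvalP x) (fvalP y)).
Definition pos_opp x := toPos (positiveV (fvalP x)).
Definition pos_oadd x y := toPos (positiveD (fvalP x) (fvalP y)).

Lemma pos_addA : associative pos_add.
Proof. by move=> x y z; apply: fval_inj; rewrite /= mulrA. Qed.
Lemma pos_addC : commutative pos_add.
Proof. by move=> x y; apply: fval_inj; rewrite /= mulrC. Qed.
Lemma pos_add0 : left_id (mono 0) pos_add.
Proof. by move=> x; apply: fval_inj; rewrite /= me0 mul1r. Qed.
Lemma pos_addN : left_inverse (mono 0) pos_opp pos_add.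
Proof.
by move=> x; apply: fval_inj; rewrite /= me0 mulVf ?positive_neq0 //; apply: fvalP.
Qed.

HB.instance Definition _ :=
  GRing.isZmodule.Build posT pos_addA pos_addC pos_add0 pos_addN.

Lemma pos_oaddA : associative pos_oadd.
Proof. by move=> x y z; apply: fval_inj; rewrite /= addrA. Qed.
Lemma pos_oaddC : commutative pos_oadd.
Proof. by move=> x y; apply: fval_inj; rewrite /= addrC. Qed.
Lemma pos_addr_oadd (x y z : posT) : x + pos_oadd y z = pos_oadd (x + y) (x + z).
Proof. by apply: fval_inj; rewrite /= mulrDr. Qed.

HB.instance Definition _ :=
  Zmodule_isAddSemifield.Build posT pos_oaddA pos_oaddC pos_addr_oadd.

Implicit Types x y : posT.

Lemma fval0 : fval 0 = 1. Proof. exact: me0. Qed.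
Lemma fvalD x y : fval (x + y) = fval x * fval y. Proof. by []. Qed.
Lemma fvalN x : fval (- x) = (fval x)^-1. Proof. by []. Qed.
Lemma fval_oadd x y : fval (oadd x y) = fval x + fval y. Proof. by []. Qed.
Lemma fval_mono g : fval (mono g) = me g. Proof. by []. Qed.
Lemma fval_neq0 x : fval x != 0. Proof. exact/positive_neq0/fvalP. Qed.

Lemma fvalMn x m : fval (x *+ m) = fval x ^+ m.
Proof. by elim: m => [|m IH]; rewrite ?fval0 // mulrS exprS fvalD IH. Qed.

Lemma fvalMz x (m : int) : fval (x *~ m) = fval x ^ m.
Proof. by case: m => m; rewrite /= ?fvalMn // NegzE mulrNz fvalN fvalMn. Qed.

Lemma fval_sum I (r : seq I) (Q : pred I) (f : I -> posT) :
  fval (\sum_(i <- r | Q i) f i) = \prod_(i <- r | Q i) fval (f i).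
Proof. by elim/big_rec2: _ => [|i a b _ <-]; rewrite ?fval0 ?fvalD. Qed.

Lemma mono_is_additive : zmod_morphism mono.
Proof.
move=> g h; apply: fval_inj; rewrite fvalD fvalN !fval_mono.
by apply: (mulIf (me_neq0 h)); rewrite -meD subrK divfK ?me_neq0.
Qed.

HB.instance Definition _ :=
  GRing.isZmodMorphism.Build (meG E) posT mono mono_is_additive.

(** ** Semifield morphisms from their values on monomials *)

Section Lift.
Variables (V : sfType) (psi : {additive meG E -> V}).

(** A semifield addition has no neutral element, so [None] is adjoined as the empty sum; the default
    [0] of [osum] is reached only on the empty list. *)
Definition oadd_big l : option V :=
  \big[oAC (@oaddA V) (@oaddC V)/None]_(g <- l) Some (psi g).

Definition osum l : V := odflt 0 (oadd_big l).

Lemma oadd_bigE l : l != [::] -> oadd_big l = Some (osum l).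
Proof.
rewrite /osum /oadd_big; case: l => // g l _; rewrite big_cons.
by case: (\big[_/_]_(_ <- _) _).
Qed.

Lemma osum1 g : osum [:: g] = psi g.
Proof. by rewrite /osum /oadd_big big_seq1. Qed.

Lemma osum_cat l l' : l != [::] -> l' != [::] ->
  osum (l ++ l') = oadd (osum l) (osum l').
Proof.
move=> h h'; rewrite {1}/osum /oadd_big big_cat /= -!/(oadd_big _).
by rewrite !oadd_bigE.
Qed.

Lemma osum_shift g l : l != [::] -> osum [seq g + h | h <- l] = psi g + osum l.
Proof.
elim: l => // h [|h' l] IH _; first by rewrite /= !osum1 raddfD.
rewrite -[h :: _ :: _]cat1s map_cat !osum_cat // IH // addr_oaddr /=.
by rewrite !osum1 raddfD.
Qed.

Lemma osum_lprod l l' : l != [::] -> l' != [::] ->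
  osum (lprod l l') = osum l + osum l'.
Proof.
move=> + h'; elim: l => // g [|g' l] IH _.
  by rewrite /lprod allpairs1l osum_shift // osum1.
have -> : lprod (g :: g' :: l) l' = [seq g + h | h <- l'] ++ lprod (g' :: l) l'.
  by rewrite /lprod allpairs_cons.
rewrite osum_cat ?lprod_neq_nil //; last by case: (l') h'.
rewrite osum_shift // IH // -[g :: _ :: _]cat1s osum_cat // osum1.
by rewrite ![_ + osum l']addrC addr_oaddr.
Qed.

Lemma osum_perm l l' : perm_eq l l' -> osum l = osum l'.
Proof. by move=> h; rewrite /osum /oadd_big (perm_big _ h). Qed.

Definition slift (x : posT) : V :=
  let l := ClassicalEpsilon.constructive_indefinite_description _ (fvalP x) in
  let l' := ClassicalEpsilon.constructive_indefinite_description _ (svalP l) in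
  osum (sval l) - osum (sval l').

(** Cross-multiplying two representations of [x] gives equal sums of monomials, hence equal
    multisets by [me_indep]; the value is therefore independent of the representation. *)
Lemma sliftE x l l' : l != [::] -> l' != [::] -> fval x * msum l' = msum l ->
  slift x = osum l - osum l'.
Proof.
move=> l0 l'0 e; rewrite /slift.
case: ClassicalEpsilon.constructive_indefinite_description => a ha /=.
case: ClassicalEpsilon.constructive_indefinite_description => b [a0 b0 hab] /=.
have : perm_eq (lprod a l') (lprod l b).
  apply: me_indep; rewrite -!/(msum _) !msum_lprod -e hab.
  by rewrite mulrAC divfK ?msum_neq0.
move/osum_perm; rewrite !osum_lprod // => h.
have -> : osum a = osum l + osum b - osum l' by rewrite -h; zmod.
by zmod.
Qed.

Lemma positive_repr x : exists l l',
  [/\ l != [::], l' != [::] & fval x * msum l' = msum l].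
Proof.
case: (fvalP x) => l [l' [l0 l'0 e]]; exists l, l'; split=> //.
by rewrite e divfK ?msum_neq0.
Qed.

Lemma slift_is_additive : zmod_morphism slift.
Proof.
move=> x y; have [a [b [a0 b0 hx]]] := positive_repr x.
have [c [d [c0 d0 hy]]] := positive_repr y.
rewrite (sliftE a0 b0 hx) (sliftE c0 d0 hy).
rewrite (@sliftE _ (lprod a d) (lprod b c)) ?lprod_neq_nil //.
  by rewrite !osum_lprod //; zmod.
rewrite fvalD fvalN !msum_lprod -hx -hy.
by rewrite [msum b * _]mulrCA -!mulrA mulKf ?fval_neq0 // mulrA.
Qed.

HB.instance Definition _ :=
  GRing.isZmodMorphism.Build posT V slift slift_is_additive.

Lemma slift_oadd : {morph slift : x y / oadd x y}.
Proof.
move=> x y; have [a [b [a0 b0 hx]]] := positive_repr x.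
have [c [d [c0 d0 hy]]] := positive_repr y.
rewrite (sliftE a0 b0 hx) (sliftE c0 d0 hy).
rewrite (@sliftE _ (lprod a d ++ lprod c b) (lprod b d)) ?lprod_neq_nil ?cat_neq_nil //.
  rewrite osum_cat ?lprod_neq_nil // !osum_lprod //.
  rewrite addrC addr_oaddr; congr oadd; zmod.
  by rewrite lprod_neq_nil.
by rewrite fval_oadd msum_cat !msum_lprod -hx -hy; ring.
Qed.

Lemma slift_mono g : slift (mono g) = psi g.
Proof.
have e : fval (mono g) * msum [:: 0] = msum [:: g].
  by rewrite fval_mono !msum1 me0 mulr1.
by rewrite (sliftE _ _ e) // !osum1 raddf0 subr0.
Qed.

End Lift.
End MonomialSums.
Arguments fval : simpl never.

(* [laurent l l' x]: x is a Laurent polynomial, the difference of the sums of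
   the monomials in l and in l', with no cancellation. *)
Definition laurent (E : mono_emb) (l l' : seq (meG E)) (x : posT E) : Prop :=
  (forall g, g \in l -> g \notin l') /\ fval x + msum l' = msum l.

Section LaurentPositive.
Variables (E : mono_emb).

Lemma fval_osum (E' : mono_emb) (psi : {additive meG E -> posT E'}) l :
  l != [::] -> fval (osum psi l) = \sum_(g <- l) fval (psi g).
Proof.
elim: l => // g [|g' l] IH _; first by rewrite osum1 big_seq1.
by rewrite -[g :: _ :: _]cat1s osum_cat // fval_oadd IH // osum1 big_cat big_seq1.
Qed.

(** Clearing the denominator of [x] yields an equality of multisets of monomials, which passes to
    the values under [psi]. This evaluates a Laurent polynomial with negative terms by a map defined
    only on positive elements. *)
Lemma slift_laurent (E' : mono_emb) (psi : {additive meG E -> posT E'})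
    (l l' : seq (meG E)) x : fval x + msum l' = msum l ->
  fval (slift psi x) + \sum_(g <- l') fval (psi g) = \sum_(g <- l) fval (psi g).
Proof.
move=> e; have [a [b [a0 b0 hx]]] := positive_repr x.
rewrite (sliftE _ a0 b0 hx) fvalD fvalN !fval_osum //.
set f := fun g => fval (psi g).
have fD g h : f (g + h) = f g * f h by rewrite /f raddfD.
have f_lprod u v : \sum_(g <- lprod u v) f g = (\sum_(g <- u) f g) * (\sum_(g <- v) f g).
  rewrite /lprod big_allpairs_dep mulr_suml; apply: eq_bigr => g _.
  by rewrite mulr_sumr; apply: eq_bigr => h _; rewrite fD.
have : perm_eq (a ++ lprod b l') (lprod b l).
  apply: me_indep; rewrite -!/(msum _) msum_cat !msum_lprod -hx -e.
  by rewrite mulrDr mulrC.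
move=> pe; have : \sum_(g <- a ++ lprod b l') f g = \sum_(g <- lprod b l) f g.
  exact: perm_big.
rewrite big_cat /= !f_lprod => h.
have nz : \sum_(g <- b) f g != 0 by rewrite -fval_osum // fval_neq0.
apply: (mulfI nz); rewrite -h mulrDr; congr (_ + _).
by rewrite mulrC divfK.
Qed.

Section Valuation.
Variable w : {additive meG E -> int}.

Lemma osum_min_le l g : g \in l -> osum w l <= w g.
Proof.
elim: l => // h [|h' l] IH; first by rewrite inE osum1 => /eqP ->.
rewrite -[h :: _ :: _]cat1s osum_cat // osum1 mem_cat => /orP[|/IH le].
  by rewrite inE => /eqP ->; rewrite ge_min lexx.
by rewrite ge_min le orbT.
Qed.

Lemma osum_min_mem l : l != [::] -> exists2 g, g \in l & osum w l = w g.
Proof.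
elim: l => // h [|h' l] IH _; first by exists h; rewrite ?mem_head ?osum1.
have [//|g hg e] := IH; rewrite -[h :: _ :: _]cat1s osum_cat // osum1 e.
rewrite /oadd /= minEle; case: ifP => _; first by exists h; rewrite ?mem_head.
by exists g; rewrite // inE hg orbT.
Qed.

(** The initial part of a product is the product of the initial parts. *)
Lemma filter_lprod (a b : seq (meG E)) (d m : int) :
  (forall g, g \in a -> d <= w g) -> (forall g, g \in b -> m <= w g) ->
  [seq g <- lprod a b | w g == d + m] =
  lprod [seq g <- a | w g == d] [seq g <- b | w g == m].
Proof.
move=> ha hb; elim: a ha => // g a IH ha; rewrite /lprod !allpairs_cons.
rewrite filter_cat -/(lprod _ _) IH => [|h hh]; last first.
  by apply: ha; rewrite inE hh orbT.
have dg : d <= w g by apply: ha; rewrite mem_head.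
rewrite [filter _ (g :: a)]/=; case: eqVneq => [e|ne].
  rewrite /lprod allpairs_cons; congr (_ ++ _); rewrite filter_map; congr map.
  by apply: eq_filter => h /=; rewrite raddfD e (inj_eq (addrI _)).
rewrite (_ : filter _ _ = [::]) //; apply/eqP; rewrite -[_ == _]negbK -has_filter.
apply/hasPn => k /mapP[h hh ->]; rewrite raddfD; apply/eqP => e.
have := hb h hh; have : d < w g by rewrite lt_neqAle eq_sym ne.
by lia.
Qed.

(* Otherwise the terms of minimal weight in l and in l' would cancel against
   each other, although l and l' are disjoint. *)
Lemma slift_valuation l l' x : laurent l l' x ->
  (forall g, g \in l ++ l' -> slift w x <= w g) /\
  (exists2 g, g \in l ++ l' & slift w x = w g).
Proof.
case=> dis e; have [a [b [a0 b0 hx]]] := positive_repr x.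
rewrite (sliftE _ a0 b0 hx).
have pe : perm_eq (a ++ lprod b l') (lprod b l).
  apply: me_indep; rewrite -!/(msum _) msum_cat !msum_lprod -hx -e.
  by rewrite mulrDr mulrC.
have ll0 : l ++ l' != [::].
  apply/negP=> /eqP; case: l {dis} e {pe} => // + /= l'0; rewrite l'0 /msum.
  by rewrite !big_nil addr0 => /eqP; rewrite (negPf (fval_neq0 _)).
set m := osum w (l ++ l').
have mle g : g \in l ++ l' -> m <= w g by exact: osum_min_le.
have [g0 g0l mE] := osum_min_mem ll0; rewrite -/m in mE.
suff -> : osum w a - osum w b = m by split=> //; exists g0.
set d := osum w b; have dle := @osum_min_le b; rewrite -/d in dle.
have [ga gaa aE] := osum_min_mem a0; have [gb gbb bE] := osum_min_mem b0.
have ge : d + m <= osum w a.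
  have : ga \in lprod b l by rewrite -(perm_mem pe) mem_cat gaa.
  case/allpairsP=> [[g h]] /= [hg hh gE]; rewrite aE gE raddfD lerD ?dle ?mle //.
  by rewrite mem_cat hh.
suff : ~ (d + m < osum w a) by move: ge; lia.
(* No term of [a] has weight [d + m], so at this weight the initial parts of [lprod b l'] and
   [lprod b l] coincide; cancelling that of [b] gives [l] and [l'] a common monomial. *)
move=> lt; have := perm_filter (fun g => w g == d + m) pe.
rewrite filter_cat (_ : [seq g <- a | _] = [::]) /=; last first.
  apply/eqP; rewrite -[_ == _]negbK -has_filter; apply/hasPn => g ga'.
  by have := osum_min_le ga'; apply: contraTneq => ->; rewrite -ltNge.
rewrite !filter_lprod //; try by move=> g h; apply: mle; rewrite mem_cat h ?orbT.
set b' := filter _ b; set u' := filter _ l'; set u := filter _ l => pe'.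
have : msum (lprod b' u') = msum (lprod b' u) by apply: perm_big.
rewrite !msum_lprod.
have b'0 : b' != [::].
  by rewrite -has_filter; apply/hasP; exists gb => //; rewrite -bE.
move/(mulfI (msum_neq0 b'0))/me_indep/perm_mem => uE.
have : g0 \in u.
  move: g0l; rewrite mem_cat => /orP[h|h]; last rewrite -uE.
    by rewrite mem_filter h mE eqxx.
  by rewrite mem_filter h mE eqxx.
move=> h0; have := h0; rewrite -uE !mem_filter => /andP[_].
by apply/negP/dis; move: h0; rewrite mem_filter => /andP[].
Qed.

End Valuation.

(** The three valuations are compared at a monomial where [w] attains its minimum. *)
Lemma slift_superadditive (w1 w2 w : {additive meG E -> int}) l l' x :
  laurent l l' x -> (forall g, w g = w1 g + w2 g) ->
  slift w1 x + slift w2 x <= slift w x.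
Proof.
move=> hx hw; have [_ [g gl ->]] := slift_valuation w hx.
have [/(_ g gl) h1 _] := slift_valuation w1 hx.
by have [/(_ g gl) h2 _] := slift_valuation w2 hx; rewrite hw lerD.
Qed.

End LaurentPositive.

(** * Laurent monomials *)

Section LaurentMonomials.
Variables (n : nat) (R : comNzRingType) (L : fieldType).
Variables (Phi : {rmorphism {mpoly R[n]} -> L}).
Hypothesis Phi_inj : forall p, Phi p = 0 -> p = 0.
Implicit Types g : {ffun 'I_n -> int}.

Definition lmono g : L := \prod_i Phi 'X_i ^ g i.

Lemma PhiX_neq0 i : Phi 'X_i != 0.
Proof.
apply/eqP=> /Phi_inj /(congr1 (mcoeff U_(i))).
by rewrite mcoeff0 mcoeffX eqxx => /eqP; rewrite oner_eq0.
Qed.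

Lemma lmono0 : lmono 0 = 1.
Proof. by rewrite /lmono big1 // => i _; rewrite ffunE expr0z. Qed.

Lemma lmonoD g h : lmono (g + h) = lmono g * lmono h.
Proof.
rewrite /lmono -big_split; apply: eq_bigr => i _.
by rewrite ffunE exprzDr // unitfE PhiX_neq0.
Qed.

Lemma lmono_shift (N : nat) g (m : 'X_{1..n}) :
  (forall i, (m i)%:Z = g i + N%:Z) ->
  lmono g * \prod_i Phi 'X_i ^+ N = Phi 'X_[m].
Proof.
move=> hm; rewrite /lmono -big_split mpolyXE_id rmorph_prod.
apply: eq_bigr => i _ /=; rewrite rmorphXn /= -[RHS]/(Phi 'X_i ^ (m i)%:Z) hm.
by rewrite exprzDr // unitfE PhiX_neq0.
Qed.

Lemma lmono_indep (l : seq (R * {ffun 'I_n -> int})) :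
  \sum_(z <- l) Phi (z.1)%:MP * lmono z.2 = 0 ->
  forall g, \sum_(z <- l | z.2 == g) z.1 = 0.
Proof.
move=> h0 g; pose bd (f : {ffun 'I_n -> int}) := (\sum_i `|f i|)%N.
(* Large enough for all exponents of [l] and of [g] to become nonnegative after a shift by [N],
   which turns the relation into one between polynomials. *)
pose N := (bd g + \sum_(z <- l) bd z.2)%N.
have leN f : (bd f <= N)%N -> forall i, 0 <= f i + N%:Z.
  move=> h i; have : (`|f i| <= N)%N.
    by apply: leq_trans h; rewrite /bd (bigD1 i) //= leq_addr.
  by lia.
pose mm (f : {ffun 'I_n -> int}) : 'X_{1..n} := [multinom `|(f i + N%:Z)%R|%N | i < n].
have mmE f : (bd f <= N)%N -> forall i, (mm f i)%:Z = f i + N%:Z.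
  by move=> /leN h i; rewrite mnmE gez0_abs.
have zN z : z \in l -> (bd z.2 <= N)%N.
  by move=> zl; rewrite /N (big_rem z) //=; lia.
have gN : (bd g <= N)%N by rewrite leq_addr.
have /Phi_inj : Phi (\sum_(z <- l) z.1%:MP * 'X_[mm z.2]) = 0.
  rewrite rmorph_sum -[RHS](mul0r (\prod_i Phi 'X_i ^+ N)) -[X in _ = X * _]h0 mulr_suml.
  apply: eq_big_seq => z zl; rewrite rmorphM -mulrA; congr (_ * _).
  by rewrite (lmono_shift (mmE _ (zN z zl))).
move/(congr1 (mcoeff (mm g))); rewrite mcoeff0 raddf_sum /= => hg; rewrite -[RHS]hg.
rewrite [RHS](bigID (fun z => z.2 == g)) /= [X in _ = _ + X]big1_seq ?addr0.
  by apply: eq_bigr => z /eqP ->; rewrite mcoeffCM mcoeffX eqxx mulr1.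
move=> z /andP[zg zl]; rewrite mcoeffCM mcoeffX.
case: eqP => [e|]; last by rewrite mulr0.
case/eqP: zg; apply/ffunP=> i.
have := mmE _ (zN z zl) i; rewrite e (mmE _ gN) => /addIr ->//.
Qed.

End LaurentMonomials.

Lemma sum1_countr (R : pzSemiRingType) (T : Type) (l : seq T) (Q : pred T) :
  \sum_(x <- l | Q x) 1 = (count Q l)%:R :> R.
Proof. by rewrite -sum1_count natr_sum. Qed.

(** * The universal semifield *)

Section Universal.
Variable n : nat.
Notation K0 := {fraction {mpoly int[n]}}.
Notation G := {ffun 'I_n -> int}.

Lemma tofrac_inj0 (p : {mpoly int[n]}) : tofrac p = 0 -> p = 0.
Proof. by move/eqP; rewrite tofrac_eq0 => /eqP. Qed.

Definition umono : G -> K0 := lmono (@tofrac {mpoly int[n]}).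

Lemma umono_indep (l l' : seq G) :
  \sum_(g <- l) umono g = \sum_(g <- l') umono g -> perm_eq l l'.
Proof.
move=> e; apply/allP=> g _; apply/eqP => /=.
have := @lmono_indep n int K0 (@tofrac _) tofrac_inj0
  ([seq (1, h) | h <- l] ++ [seq (-1, h) | h <- l']).
rewrite big_cat /= !big_map /= => /(_ _ g).
rewrite big_cat /= !big_map /= sumrN !sum1_countr => h.
suff /h : \sum_(h <- l) tofrac 1%:MP_[n] * lmono (@tofrac _) h
    + \sum_(h <- l') tofrac (-1)%:MP_[n] * lmono (@tofrac _) h = 0 :> K0.
  by move/eqP; rewrite subr_eq0 eqr_nat => /eqP.
under eq_bigr do rewrite rmorph1 mul1r.
under [X in _ + X]eq_bigr do rewrite !rmorphN1 mulN1r.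
by rewrite sumrN; move: e; rewrite /umono => ->; rewrite subrr.
Qed.

Definition Uemb : mono_emb := MonoEmb (lmono0 _) (lmonoD tofrac_inj0) umono_indep.
Notation U := (posT Uemb).

Definition delta (i : 'I_n) : G := [ffun j => (j == i)%:R].

Definition Uvar : {ffun 'I_n -> U} := [ffun i => mono (delta i : meG Uemb)].

Lemma fval_Uvar i : fval (Uvar i) = tofrac 'X_i.
Proof.
rewrite ffunE fval_mono /= /umono /lmono (bigD1 i) //= ffunE eqxx expr1z.
by rewrite big1 ?mulr1 // => j ji; rewrite ffunE (negPf ji) expr0z.
Qed.

Section Evaluation.
Variables (V : sfType) (y : {ffun 'I_n -> V}).

Definition ueval_mono (g : meG Uemb) : V := \sum_i y i *~ (g : G) i.

Lemma ueval_mono_additive : zmod_morphism ueval_mono.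
Proof.
move=> g h; rewrite /ueval_mono -sumrB; apply: eq_bigr => i _.
by rewrite !ffunE mulrzBr.
Qed.

HB.instance Definition _ :=
  GRing.isZmodMorphism.Build (meG Uemb) V ueval_mono ueval_mono_additive.

(** The universal property: a subtraction-free rational function can be evaluated at any point of
    any semifield. *)
Definition ueval : {additive U -> V} := slift ueval_mono.

Lemma ueval_oadd : {morph ueval : x x' / oadd x x'}.
Proof. exact: slift_oadd. Qed.

Lemma ueval_Uvar i : ueval (Uvar i) = y i.
Proof.
rewrite ffunE /= slift_mono /= /ueval_mono (bigD1 i) //= ffunE eqxx mulr1z.
by rewrite big1 ?addr0 // => j ji; rewrite ffunE (negPf ji) mulr0z.
Qed.

Lemma ueval_Uvars : [ffun i => ueval (Uvar i)] = y.
Proof. by apply/ffunP=> i; rewrite ffunE ueval_Uvar. Qed.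

Variables (M : tree n -> 'M[int]_n) (cM : coherent M).

Lemma ueval_Fpat s t i : ueval (Fpat M s Uvar t i) = Fpat M s y t i.
Proof. by rewrite (Fpat_morph cM) ?ueval_Uvars //; apply: ueval_oadd. Qed.

End Evaluation.
End Universal.
Notation U n := (posT (Uemb n)).

(** * Cluster variables as positive elements *)

(** An alias that carries the additive notation while [P] keeps its multiplicative one. *)
Definition addsf (P : semifieldType) : Type := P.

Section AddSemifield.
Variable P : semifieldType.

HB.instance Definition _ := Choice.copy (addsf P) P.

Lemma addsf_addA : associative (fun p q : addsf P => (p * q)%g : addsf P).
Proof. exact: mulgA. Qed.
Lemma addsf_addC : commutative (fun p q : addsf P => (p * q)%g : addsf P).
Proof. exact: sf_mulC. Qed.
Lemma addsf_add0 : left_id (1%g : addsf P) (fun p q : addsf P => (p * q)%g : addsf P).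
Proof. exact: mul1g. Qed.
Lemma addsf_addN : left_inverse (1%g : addsf P) (fun p : addsf P => p^-1%g : addsf P)
  (fun p q : addsf P => (p * q)%g : addsf P).
Proof. exact: mulVg. Qed.

HB.instance Definition _ := GRing.isZmodule.Build (addsf P)
  addsf_addA addsf_addC addsf_add0 addsf_addN.

Lemma addsf_addr_oadd (p q r : addsf P) :
  p + (oplus q r : addsf P) = (oplus (p + q) (p + r) : addsf P).
Proof. exact: sf_mulDr. Qed.

HB.instance Definition _ := Zmodule_isAddSemifield.Build (addsf P)
  (@oplusA P) (@oplusC P) addsf_addr_oadd.

Lemma addsfMn (p : P) m : ((p : addsf P) *+ m) = (p ^+ m)%g.
Proof. by elim: m => [|m IH] //; rewrite mulrS IH expgS. Qed.

Lemma addsfMz (p : P) m : ((p : addsf P) *~ m) = expgz p m.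
Proof. by case: m => m /=; rewrite -addsfMn. Qed.

End AddSemifield.

(** * The Laurent phenomenon *)

Section Localization.
Variable n : nat.
Notation mp := {mpoly int[n]}.
Notation K0 := {fraction mp}.
Notation G := {ffun 'I_n -> int}.
Implicit Types (R p q : mp) (z : K0).

(** Membership in the localization of the polynomial ring at the powers of [R]; for [R = xall] these
    are the Laurent polynomials. *)
Definition Loc R z : Prop := exists k p, z * tofrac R ^+ k = tofrac p.

Lemma Loc_mpoly R p : Loc R (tofrac p).
Proof. by exists 0%N, p; rewrite mulr1. Qed.

Lemma Loc1 R : Loc R 1.
Proof. by rewrite -(rmorph1 (@tofrac mp)); apply: Loc_mpoly. Qed.

Lemma LocM R z z' : Loc R z -> Loc R z' -> Loc R (z * z').
Proof.
case=> k [p hp] [k' [p' hp']]; exists (k + k')%N, (p * p').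
by rewrite rmorphM /= -hp -hp' exprD mulrACA.
Qed.

Lemma LocD R z z' : Loc R z -> Loc R z' -> Loc R (z + z').
Proof.
case=> k [p hp] [k' [p' hp']].
exists (k + k')%N, (p * R ^+ k' + p' * R ^+ k).
by rewrite rmorphD !rmorphM !rmorphXn /= -hp -hp' exprD; ring.
Qed.

Lemma LocN R z : Loc R z -> Loc R (- z).
Proof. by case=> k [p hp]; exists k, (- p); rewrite rmorphN mulNr hp. Qed.

Lemma Loc_sum R (I : Type) (r : seq I) (f : I -> K0) :
  (forall i, Loc R (f i)) -> Loc R (\sum_(i <- r) f i).
Proof.
move=> h; elim/big_ind: _ => //; last exact: LocD.
by rewrite -(rmorph0 (@tofrac mp)); apply: Loc_mpoly.
Qed.

Lemma Loc_inv R p q : R != 0 -> p * q = R -> Loc R (tofrac p)^-1.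
Proof.
move=> R0 e; exists 1%N, q; rewrite expr1 -e rmorphM /= mulKf //.
by rewrite tofrac_eq0; apply: contraNneq R0 => p0; rewrite -e p0 mul0r.
Qed.

Definition LocU R z : Prop := Loc R z /\ Loc R z^-1.

Lemma LocU1 R : LocU R 1.
Proof. by split; rewrite ?invr1; apply: Loc1. Qed.

Lemma LocUM R z z' : LocU R z -> LocU R z' -> LocU R (z * z').
Proof. by case=> h1 h2 [h3 h4]; split; rewrite ?invfM; apply: LocM. Qed.

Lemma LocUV R z : LocU R z -> LocU R z^-1.
Proof. by case=> h1 h2; split; rewrite ?invrK. Qed.

Lemma LocUX R z (m : int) : LocU R z -> LocU R (z ^ m).
Proof.
move=> h; have hn k : LocU R (z ^+ k).
  by elim: k => [|k IH]; [apply: LocU1|rewrite exprS; apply: LocUM].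
by case: m => k; [exact: (hn k)|exact: (LocUV (hn k.+1))].
Qed.

Lemma LocU_prod R (I : Type) (r : seq I) (f : I -> K0) :
  (forall i, LocU R (f i)) -> LocU R (\prod_(i <- r) f i).
Proof. by move=> h; elim/big_ind: _ => //; [apply: LocU1|apply: LocUM]. Qed.

Lemma LocU_dvd R p q : R != 0 -> p * q = R -> LocU R (tofrac p).
Proof. by move=> R0 e; split; [apply: Loc_mpoly|apply: Loc_inv R0 e]. Qed.

Definition xall : mp := \prod_i 'X_i.

Lemma mpX_neq0 i : 'X_i != 0 :> mp.
Proof. by have := PhiX_neq0 (@tofrac_inj0 n) i; rewrite tofrac_eq0. Qed.

Lemma xall_neq0 : xall != 0.
Proof. by rewrite /xall prodf_seq_neq0; apply/allP=> i _; rewrite mpX_neq0. Qed.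

Lemma LocU_umono p (g : G) : xall * p != 0 -> LocU (xall * p) (umono g).
Proof.
move=> R0; apply: LocU_prod => i; apply: LocUX.
apply: (@LocU_dvd _ _ (\prod_(j | j != i) 'X_j * p)) => //.
by rewrite mulrA /xall [in RHS](bigD1 i).
Qed.

(** The substitution $X_i=-1$, used to detect divisibility by $1+X_i$. *)
Definition theta (i : 'I_n) : mp -> mp :=
  mmap (@mpolyC n int) (fun l => if l == i then -1 else 'X_l).

HB.instance Definition _ i := GRing.RMorphism.on (theta i).

Lemma thetaX i l : theta i 'X_l = if l == i then -1 else 'X_l.
Proof. by rewrite /theta mmapX mmap1U. Qed.

(** The congruence of [p] and [theta i p] modulo $1+X_i$ holds for constants and variables and is
    stable under sums and products. *)
Lemma theta_ker i p : theta i p = 0 -> exists q, p = (1 + 'X_i) * q.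
Proof.
suff [q] : exists q, p - theta i p = (1 + 'X_i) * q.
  by move=> e h; exists q; rewrite -e h subr0.
have closedM p1 p2 : (exists q, p1 - theta i p1 = (1 + 'X_i) * q) ->
    (exists q, p2 - theta i p2 = (1 + 'X_i) * q) ->
    exists q, p1 * p2 - theta i (p1 * p2) = (1 + 'X_i) * q.
  case=> q1 h1 [q2 h2]; exists (q1 * p2 + theta i p1 * q2).
  by rewrite mulrDr mulrA -h1 mulrCA -h2 rmorphM; ring.
have cl1 : exists q, 1 - theta i 1 = (1 + 'X_i) * q.
  by exists 0; rewrite rmorph1 subrr mulr0.
have clX l : exists q, 'X_l - theta i 'X_l = (1 + 'X_i) * q.
  rewrite thetaX; case: eqP => [->|_]; last by exists 0; rewrite subrr mulr0.
  by exists 1; rewrite mulr1 opprK addrC.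
elim/mpolyind: p => [|c m p _ _ [q hq]]; first by exists 0; rewrite rmorph0 mulr0 subrr.
have [q' hq'] : exists q, 'X_[m] - theta i 'X_[m] = (1 + 'X_i) * q.
  rewrite mpolyXE_id; elim/big_ind: _ => // l _.
  by elim: (m l) => [|k IH]; rewrite ?expr0 // exprS; apply: closedM.
exists (c%:MP * q' + q); rewrite -mul_mpolyC rmorphD rmorphM /=.
rewrite (_ : theta i c%:MP = c%:MP); last by rewrite /theta mmapC.
by rewrite mulrDr -hq mulrCA -hq'; ring.
Qed.

Lemma theta_1X i : theta i (1 + 'X_i) = 0.
Proof. by rewrite rmorphD rmorph1 /= thetaX eqxx subrr. Qed.

Lemma onepX_neq0 i : 1 + 'X_i != 0 :> mp.
Proof.
apply/eqP=> /(congr1 (mcoeff U_(i))); rewrite mcoeffD mcoeff1 mcoeffX mcoeff0 eqxx.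
by rewrite mnm1_eq0.
Qed.

Lemma theta_divide i z a p q R : theta i R != 0 ->
  z * tofrac (1 + 'X_i) ^+ a = tofrac p -> z * tofrac R = tofrac q ->
  exists p', z = tofrac p'.
Proof.
move=> R0; elim: a => [|a IH] in p *; first by rewrite mulr1 => ->; exists p.
move=> hp hq.
have /eqP : tofrac (p * R) = tofrac (q * (1 + 'X_i) ^+ a.+1).
  by rewrite !rmorphM rmorphXn /= -hp -hq; ring.
rewrite tofrac_eq => /eqP e.
have : theta i p = 0.
  have := congr1 (theta i) e; rewrite !rmorphM /= rmorphXn /= theta_1X expr0n mulr0.
  by move/eqP; rewrite mulf_eq0 (negPf R0) orbF => /eqP.
case/theta_ker=> p' hp'; apply: (IH p') => //.
have nz : tofrac (1 + 'X_i) != 0 :> K0 by rewrite tofrac_eq0 onepX_neq0.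
by apply: (mulfI nz); rewrite -rmorphM /= -hp' -hp exprS; ring.
Qed.

(** The element $1+X_i$ is prime and divides neither [R] nor [xall], so the second denominator
    allows every power of $1+X_i$ to be removed from the first. *)
Lemma Loc_glue i z R : theta i R != 0 -> Loc (xall * (1 + 'X_i)) z ->
  Loc (xall * R) z -> Loc xall z.
Proof.
move=> R0 [a [p hp]] [b [q hq]].
have x0 : theta i xall != 0.
  rewrite /xall rmorph_prod prodf_seq_neq0; apply/allP=> l _ /=.
  by rewrite thetaX; case: ifP => _; rewrite ?oppr_eq0 ?oner_eq0 ?mpX_neq0.
have [p' hp'] : exists p', z * tofrac xall ^+ a = tofrac p'.
  apply: (@theta_divide i _ a p (q * xall ^+ a) ((xall * R) ^+ b)).
  - by rewrite rmorphXn rmorphM /= expf_neq0 // mulf_neq0.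
  - by rewrite -hp rmorphM /= exprMn mulrA.
  - by rewrite rmorphM !rmorphXn /= -hq; ring.
by exists a, p'.
Qed.

Lemma laurent_of_Loc (x : U n) : Loc xall (fval x) -> exists l l', laurent l l' x.
Proof.
case=> k [p hp].
pose sh (m : 'X_{1..n}) : G := [ffun i => (m i)%:Z - k%:Z].
have shE m : tofrac 'X_[m] = umono (sh m) * tofrac xall ^+ k.
  rewrite -(@lmono_shift _ _ _ _ (@tofrac_inj0 n) k (sh m) m) => [|i].
    by rewrite /xall rmorph_prod -prodrXl.
  by rewrite ffunE subrK.
have sh_inj : injective sh.
  move=> m m' /ffunP e; apply/mnmP=> i; have := e i; rewrite !ffunE => /addIr.
  by case.
(* Each monomial is repeated as often as the absolute value of its coefficient; the sign of the
   coefficient selects the list. *)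
pose ls (b : bool) : seq (meG (Uemb n)) :=
  flatten [seq nseq `|p@_m| (sh m) | m <- msupp p & (0 < p@_m) == b].
have msum_ls b : msum (ls b) =
  \sum_(m <- msupp p | (0 < p@_m) == b) (umono (sh m)) *+ `|p@_m|%N.
  rewrite /ls /msum big_flatten big_map big_filter /=.
  by apply: eq_bigr => m _; rewrite big_nseq; elim: `|_|%N => //= u ->; rewrite mulrS.
exists (ls true), (ls false); split.
  move=> g /flatten_mapP[m]; rewrite mem_filter => /andP[hm _] /nseqP[-> _].
  apply/negP=> /flatten_mapP[m']; rewrite mem_filter => /andP[hm' _] /nseqP[e _].
  by move: hm'; rewrite -(sh_inj _ _ e) (eqP hm).
have nz : tofrac xall ^+ k != 0 :> K0 by rewrite expf_neq0 // tofrac_eq0 xall_neq0.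
apply: (mulIf nz); rewrite mulrDl hp {1}[p]mpolyE rmorph_sum /=.
rewrite (bigID (fun m => (0 < p@_m) == true)) /= !msum_ls !mulr_suml -addrA.
rewrite [X in _ + X = _](_ : _ = 0) ?addr0.
  apply: eq_bigr => m; rewrite eqb_id => hm.
  rewrite -mul_mpolyC rmorphM /= shE mulrA; congr (_ * _).
  rewrite -{1}(gtz0_abs hm) mulrC -mulr_natr; congr (_ * _).
  by rewrite -[RHS](rmorph_nat (@tofrac mp)) -mpolyC_nat natz.
rewrite (eq_bigl (fun m => (0 < p@_m) == false)) => [|m]; last by case: (0 < _).
rewrite -big_split big1_seq //= => m; rewrite eqbF_neg -leNgt => /andP[hm _].
rewrite -mul_mpolyC rmorphM /= shE mulrA -mulrDl -[X in _ + X]mulr_natr.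
rewrite [umono _ * _]mulrC -mulrDl [X in X * _ * _](_ : _ = 0) ?mul0r //.
rewrite -(rmorph_nat (@tofrac mp)) -mpolyC_nat /= -rmorphD -mpolyCD /=.
have -> : p@_m + (`|p@_m|%N)%:R = 0 by rewrite natz lez0_abs // subrr.
by rewrite mpolyC0 rmorph0.
Qed.

End Localization.

(** * The rank-two computation at three consecutive mutations *)

Lemma rank_two_field0 (K : fieldType) (x : K) : x != 0 -> 1 + x != 0 ->
  x * ((1 + x)^-1 * (1 + x^-1)) = 1.
Proof. by move=> x0 x1; field; rewrite x0 x1. Qed.

Lemma rank_two_field1 (K : fieldType) (x s v p w : K) :
  x != 0 -> 1 + x != 0 -> s != 0 -> s = v + (1 + x) * p * w ->
  x * ((1 + x)^-1 * s * (1 + x^-1 * (v / s))) = v + x * p * w.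
Proof.
move=> x0 x1 s0 e.
have -> : x * ((1 + x)^-1 * s * (1 + x^-1 * (v / s))) = (x * s + v) / (1 + x).
  by field; rewrite x0 x1 s0.
by rewrite e; field.
Qed.

Lemma rank_two_field2 (K : fieldType) (x z s p w : K) :
  x != 0 -> 1 + x != 0 -> s = 1 + z * ((1 + x) * p) * w ->
  x * ((1 + x)^-1 * (1 + x^-1 * s)) = 1 + z * p * w.
Proof. by move=> x0 x1 ->; field; rewrite x0 x1. Qed.

Section RankTwo.
Variables (A : idomainType) (K : fieldType) (f : {rmorphism A -> K}).
Variables (th : {rmorphism A -> A}) (Xi Xj : A).
Hypotheses (f_neq0 : forall p, p != 0 -> f p != 0) (th_Xi : th Xi = -1).
Hypotheses (th_Xj : th Xj = Xj) (Xi0 : Xi != 0) (Xi10 : 1 + Xi != 0).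
Hypothesis Xj_unit : forall p, 1 + Xj * p != 0.
Hypothesis Xj_nat : forall e m, Xj * (-1) ^+ e - m%:R != 0.
Let x : K := f Xi.
Let z : K := f Xj.

Let x0 : x != 0. Proof. exact: f_neq0. Qed.
Let x1E : f (1 + Xi) = 1 + x. Proof. by rewrite rmorphD rmorph1. Qed.
Let x10 : 1 + x != 0. Proof. by rewrite -x1E f_neq0. Qed.
Let th_1X : th (1 + Xi) = 0. Proof. by rewrite rmorphD rmorph1 th_Xi subrr. Qed.

(* The right-hand sides of the exchange relations for F_j at t2 and F_i at t3
   along t0 -i- t1 -j- t2 -i- t3, up to monomials. *)
Lemma rank_two_poly (b c : int) :
  b * c <= 0 -> (b * c = 0 -> b = 0 /\ c = 0) ->
  let Y := z * x ^ pospart b * (1 + x) ^ (- b) in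
  exists P P' : A,
  [/\ th P != 0, th P' != 0,
      (1 + x) ^ pospart b * (1 + Y) = f P &
      x * ((1 + x)^-1 * ((1 + x) ^ pospart b * (1 + Y)) ^ pospart (- c)
           * (1 + x^-1 * Y ^ pospart (- c) * (1 + Y) ^ c)) = f P'].
Proof.
move=> bc0 bcE Y.
(* Sign-skew-symmetry leaves $b=c=0$, $b>0>c$ and $b<0<c$. *)
have : (b = 0 /\ c = 0) \/ (exists b' c' : nat, b = b'.+1 /\ c = - (c'.+1%:Z))
    \/ (exists b' c' : nat, b = - (b'.+1%:Z) /\ c = c'.+1).
  have [b0|b0|b0] := ltgtP b 0; have [c0|c0|c0] := ltgtP c 0; try by (
    try by (left; apply: bcE; nia); nia).
  - by right; right; exists `|b|.-1%N, `|c|.-1%N; split; lia.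
  - by right; left; exists `|b|.-1%N, `|c|.-1%N; split; lia.
case=> [[b0 c0]|[[b' [c' [bE cE]]]|[b' [c' [bE cE]]]]].
- exists (1 + Xj), 1; rewrite rmorphD !rmorph1 /= th_Xj; split.
  + by rewrite -[X in 1 + X]mulr1 Xj_unit.
  + exact: oner_neq0.
  + by rewrite /Y b0 pospart0 oppr0 !expr0z !mulr1 mul1r rmorphD rmorph1.
  + by rewrite c0 oppr0 pospart0 !expr0z !mulr1; apply: rank_two_field0.
- pose a : A := (1 + Xi) ^+ b'.+1; pose u : A := Xj * Xi ^+ b'.+1.
  have aE : f a = (1 + x) ^+ b'.+1 by rewrite rmorphXn /= x1E.
  have uE : f u = z * x ^+ b'.+1 by rewrite rmorphM rmorphXn.
  have a0 : f a != 0 by rewrite aE expf_neq0.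
  have pb : pospart b = b'.+1 by rewrite bE /pospart; lia.
  have pc : pospart (- c) = c'.+1 by rewrite cE /pospart; lia.
  have YE : Y = f u / f a by rewrite /Y pb bE uE aE exprnN.
  (* The cofactor in $(a+u)^{c'+1}-u^{c'+1}=aq$; dividing [a] by [1 + Xi] later lowers its exponent
     to [b']. *)
  pose q : A := \sum_(m < c'.+1) (a + u) ^+ (c'.+1.-1 - m) * u ^+ m.
  have qE : (a + u) ^+ c'.+1 = u ^+ c'.+1 + a * q.
    by rewrite -[LHS](subrK (u ^+ c'.+1)) subrXX addrK addrC.
  have th_u : th u = Xj * (-1) ^+ b'.+1.
    by rewrite rmorphM rmorphXn /= th_Xj th_Xi.
  have th_a : th a = 0 by rewrite rmorphXn /= th_1X expr0n.
  clearbody a u; have th_u0 : th u != 0.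
    by rewrite th_u -[_ * _]subr0 (Xj_nat _ 0).
  have A1 : (1 + x) ^ pospart b * (1 + Y) = f (a + u).
    rewrite YE pb -[(1 + x) ^ _]/((1 + x) ^+ b'.+1) -aE rmorphD /=.
    by rewrite mulrDr mulr1 mulrC divfK.
  exists (a + u), (u ^+ c'.+1 + Xi * (1 + Xi) ^+ b' * q); split.
  + by rewrite rmorphD /= th_a add0r.
  (* Every term of [q] is sent to the same power of [th u]. The factor [0 ^ b'] is [1] exactly for
     [b' = 0], when no factor [1 + Xi] is left to kill these terms. *)
  + have -> : th (u ^+ c'.+1 + Xi * (1 + Xi) ^+ b' * q) =
        th u ^+ c' * (th u - (0 ^ b' * c'.+1)%N%:R).
      rewrite rmorphD !rmorphM !rmorphXn th_1X th_Xi rmorph_sum /=.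
      rewrite (eq_bigr (fun=> th u ^+ c')) => [|m _]; last first.
        rewrite rmorphM !rmorphXn rmorphD /= th_a add0r -exprD subnK //.
        by rewrite -ltnS ltn_ord.
      rewrite sumr_const card_ord exprS -[th u ^+ c' *+ _]mulr_natr ?natrM ?natrX.
      by ring.
    by rewrite mulf_neq0 ?expf_neq0 // th_u Xj_nat.
  + exact: A1.
  + rewrite A1 pc -[_ ^ Posz _]/(f (a + u) ^+ c'.+1).
    rewrite -[Y ^ _]/(Y ^+ c'.+1) cE -exprnN.
    have A0 : f (a + u) != 0.
      apply: f_neq0; apply: contraNneq th_u0 => e.
      by have := congr1 th e; rewrite rmorphD /= th_a add0r rmorph0 => ->.
    have -> : 1 + Y = f (a + u) / f a.
      by rewrite -A1 pb -[(1 + x) ^ _]/((1 + x) ^+ b'.+1) -aE mulrC mulKf.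
    have -> : x^-1 * Y ^+ c'.+1 * (f (a + u) / f a) ^- c'.+1 =
        x^-1 * (f (u ^+ c'.+1) / f (a + u) ^+ c'.+1).
      rewrite -mulrA YE !exprMn rmorphXn /= invfM; congr (_ * _).
      by rewrite -!exprVn invrK mulrACA -[X in _ * X]exprMn mulVf // expr1n mulr1.
    rewrite [f (_ + _ * _ * _)]rmorphD !rmorphM !rmorphXn /= x1E.
    apply: rank_two_field1 => //; first exact: expf_neq0.
    by rewrite -rmorphXn qE rmorphD rmorphM rmorphXn /= aE -exprS.
- pose a : A := (1 + Xi) ^+ b'.+1.
  have aE : f a = (1 + x) ^+ b'.+1 by rewrite rmorphXn /= x1E.
  have pb : pospart b = 0 by rewrite bE /pospart; lia.
  have pc : pospart (- c) = 0 by rewrite cE /pospart; lia.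
  have th_a : th a = 0 by rewrite rmorphXn /= th_1X expr0n.
  have YE : Y = z * f a by rewrite /Y pb expr0z mulr1 bE opprK aE.
  pose Q : A := 1 + Xj * a.
  have QE : 1 + Y = f Q by rewrite YE rmorphD rmorph1 rmorphM.
  pose q : A := \sum_(m < c'.+1) Q ^+ m.
  have qE : Q ^+ c'.+1 = 1 + Xj * a * q.
    by rewrite -[LHS](subrK 1) subrX1 -/q [Q - 1]addrAC subrr add0r addrC.
  exists Q, (1 + Xj * (1 + Xi) ^+ b' * q); split.
  + by rewrite rmorphD rmorphM rmorph1 /= th_a mulr0 addr0 oner_neq0.
  + by rewrite rmorphD !rmorphM rmorph1 /= th_Xj -mulrA Xj_unit.
  + by rewrite pb expr0z mul1r QE.
  + rewrite pb pc !expr0z !mulr1 QE cE -[_ ^ _]/(f Q ^+ c'.+1) -rmorphXn /= qE.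
    rewrite [f (_ + _ * (1 + Xi) ^+ _ * _)]rmorphD !rmorphM rmorph1 rmorphXn /= x1E.
    apply: rank_two_field2 => //.
    by rewrite rmorphD !rmorphM rmorph1 /= aE exprS.
Qed.

End RankTwo.

(** * The caterpillar argument for F-polynomials *)

Section LaurentPhenomenon.
Variable n : nat.
Notation mp := {mpoly int[n]}.
Notation K0 := {fraction mp}.
Notation G := {ffun 'I_n -> int}.

Lemma umono0 : umono (0 : G) = 1.
Proof. exact: lmono0. Qed.

Lemma umonoD (g h : G) : umono (g + h) = umono g * umono h.
Proof. exact: (lmonoD (@tofrac_inj0 n)). Qed.

(** Equality up to a Laurent monomial, a unit wherever all variables are inverted. *)
Definition meq (z z' : K0) : Prop := exists g : G, z = umono g * z'.

Lemma meq_refl z : meq z z.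
Proof. by exists 0; rewrite umono0 mul1r. Qed.

Lemma meq_mono (g : G) z z' : meq z z' -> meq (umono g * z) z'.
Proof.
by case=> h ->; exists (g + h); rewrite umonoD mulrA.
Qed.

Lemma meqM z z' v v' : meq z z' -> meq v v' -> meq (z * v) (z' * v').
Proof.
move=> hz [g ->]; rewrite mulrCA; apply: meq_mono; case: hz => h ->.
by rewrite -mulrA; exists h.
Qed.

Lemma umonoX (g : G) (m : int) : umono g ^ m = umono (g *~ m).
Proof.
by have := fvalMz (mono (g : meG (Uemb n))) m; rewrite -raddfMz !fval_mono.
Qed.

Lemma meqX z z' (m : int) : meq z z' -> meq (z ^ m) (z' ^ m).
Proof. by case=> g ->; exists (g *~ m); rewrite expfzMl umonoX. Qed.

Lemma fval_Umono_sum (h : 'I_n -> int) :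
  fval (\sum_m Uvar n m *~ h m) = umono [ffun m => h m].
Proof.
rewrite fval_sum /umono /lmono; apply: eq_bigr => m _.
by rewrite fvalMz fval_Uvar ffunE.
Qed.

Variables (M : tree n -> 'M[int]_n) (cM : coherent M).
Notation Fu s t i := (fval (Fpat M s (Uvar n) t i)).
Notation Yu s t i := (fval (Ypat M s (Uvar n) t i)).

Lemma Fu_nbr_neq s t k i : i != k -> Fu s (nbr k t) i = Fu s t i.
Proof. by move=> ik; rewrite Fpat_nbr_neq. Qed.

Lemma Fu_init s i : Fu s s i = 1.
Proof. by rewrite Fpat_init ffunE fval0. Qed.

(** Up to monomials the sign in the recursion is immaterial, so it is taken to be [1]. *)
Lemma Fu_nbr s t k : meq (Fu s (nbr k t) k)
  ((Fu s t k)^-1 * \prod_j Fu s t j ^ pospart (- M t j k) * (1 + Yu s t k)).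
Proof.
have [h hE] := Fpat_nbr_sign cM s t k (or_introl erefl).
rewrite hE fvalD fval_Umono_sum; apply: meq_mono.
rewrite !fvalD fvalN fval_sum fval_oadd fval0 mulr1z [_ + 1]addrC.
rewrite (eq_bigr (fun j => Fu s t j ^ pospart (- M t j k))); first exact: meq_refl.
by move=> j _; rewrite fvalMz mul1r.
Qed.

Lemma Yu_nbr s t k j : j != k -> Yu s (nbr k t) j =
  Yu s t j * Yu s t k ^ pospart (M t k j) * (1 + Yu s t k) ^ (- M t k j).
Proof.
move=> jk; rewrite Ypat_nbr // ffunE (negPf jk) !fvalD fvalN !fvalMz fval_oadd fval0.
by rewrite invr_expz [_ + 1]addrC.
Qed.

Lemma Fu_first s i : meq (Fu s (nbr i s) i) (1 + tofrac 'X_i).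
Proof.
have := Fu_nbr s s i; rewrite Fu_init invr1 mul1r big1 => [|j _].
  by rewrite mul1r Ypat_init fval_Uvar.
by rewrite Fu_init exp1rz.
Qed.

Lemma umono_delta i : umono (delta i) = tofrac 'X_i :> K0.
Proof. by have := fval_Uvar i; rewrite ffunE fval_mono. Qed.

Lemma umonoN_delta i : umono (- delta i) = (tofrac 'X_i)^-1 :> K0.
Proof.
have x0 : tofrac 'X_i != 0 :> K0 by rewrite tofrac_eq0 mpX_neq0.
by apply: (mulIf x0); rewrite -{1}umono_delta -umonoD addNr umono0 mulVf.
Qed.

(** Nonvanishing at $X_i=-1$ makes the denominators met at [t3] coprime to $1+X_i$, as [Loc_glue]
    requires. *)
Lemma Fu_rank_two s i j : j != i ->
  let t1 := nbr i s in let t2 := nbr j t1 in let t3 := nbr i t2 in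
  exists A A' : mp,
  [/\ theta i A != 0, theta i A' != 0, meq (Fu s t2 j) (tofrac A) &
      meq (Fu s t3 i) (tofrac A')].
Proof.
move=> ji t1 t2 t3; have ij : i != j by rewrite eq_sym.
have [bc0 bcE] := coh_sss cM s i j.
have Xn0 p : p != 0 -> tofrac p != 0 :> K0 by rewrite tofrac_eq0.
have Xunit (p : mp) : 1 + 'X_j * p != 0.
  apply/eqP=> /(congr1 (mcoeff 0%MM)); rewrite mcoeffD mcoeff1 eqxx mcoeff0.
  by rewrite rmorphM /= mcoeffX mnm1_eq0 mul0r addr0.
have Xnat e m : 'X_j * (-1) ^+ e - m%:R != 0 :> mp.
  apply/eqP => /(congr1 (mcoeff U_(j))); rewrite mcoeffB mcoeff0 -mpolyC_nat mcoeffC.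
  have -> : (-1 : mp) ^+ e = ((-1) ^+ e)%:MP by rewrite rmorphXn rmorphN1.
  rewrite mulrC mcoeffCM mcoeffX eqxx mnm1_eq0 mulr0 mulr1 subr0 => /eqP.
  by rewrite signr_eq0.
have thj : theta i 'X_j = 'X_j by rewrite thetaX (negPf ji).
have thi : theta i 'X_i = -1 by rewrite thetaX eqxx.
have [A [A' [hA hA' eA eA']]] := @rank_two_poly mp K0 (@tofrac mp) (theta i) 'X_i 'X_j
  Xn0 thi thj (mpX_neq0 i) (onepX_neq0 i) Xunit Xnat _ _ bc0 bcE.
exists A, A'; rewrite /= in eA eA'; set Y := (_ * _ * _) in eA eA'.
have YE : Yu s t1 j = Y by rewrite (Yu_nbr _ _ ji) !Ypat_init !fval_Uvar.
have F1 l : l != i -> Fu s t1 l = 1 by move=> li; rewrite Fu_nbr_neq // Fu_init.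
have F2 : meq (Fu s t2 j) (tofrac A).
  case: (Fu_nbr s t1 j) => g ->; apply: meq_mono.
  rewrite F1 // invr1 mul1r (bigD1 i) //= big1 => [|l li]; last by rewrite F1 ?exp1rz.
  rewrite mulr1 (coh_row cM) opprK YE -eA.
  by apply: meqM; [apply: meqX; apply: Fu_first|apply: meq_refl].
split=> //; case: (Fu_nbr s t2 i) => g ->; apply: meq_mono.
have m1 : M t1 j i = - M s j i by rewrite (coh_col cM).
have m2 : M t2 j i = M s j i by rewrite (coh_row cM) m1 opprK.
have Y2 : Yu s t2 i = (tofrac 'X_i)^-1 * Y ^ pospart (- M s j i) * (1 + Y) ^ M s j i.
  rewrite (Yu_nbr _ _ ij) YE m1 opprK; congr (_ * _ * _).
  by rewrite Ypat_nbr // ffunE eqxx fvalN Ypat_init fval_Uvar.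
rewrite Y2 (bigD1 j) //= (bigD1 i) //= (coh_diag cM) oppr0 pospart0 expr0z mul1r.
rewrite big1 ?mulr1 => [|l /andP[lj li]]; last by rewrite Fu_nbr_neq // F1 ?exp1rz.
rewrite m2 Fu_nbr_neq //.
have x0 : tofrac 'X_i != 0 :> K0 by rewrite tofrac_eq0 mpX_neq0.
have -> : tofrac A' = tofrac 'X_i * ((tofrac 'X_i)^-1 * tofrac A') by rewrite mulVKf.
suff : meq ((Fu s t1 i)^-1 * Fu s t2 j ^ pospart (- M s j i) *
    (1 + (tofrac 'X_i)^-1 * Y ^ pospart (- M s j i) * (1 + Y) ^ M s j i))
  ((tofrac 'X_i)^-1 * tofrac A').
  by case=> h ->; rewrite mulVKf // -umonoN_delta; exists (h - delta i);
    rewrite umonoD mulrA.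
rewrite -eA' mulKf //; apply: meqM; last exact: meq_refl.
rewrite eA; apply: meqM; last exact: meqX.
by have := meqX (-1) (Fu_first s i); rewrite !exprN1.
Qed.

Lemma LocU_meq R z z' : xall n * R != 0 ->
  meq z z' -> LocU (xall n * R) z' -> LocU (xall n * R) z.
Proof. by move=> R0 [g ->] h; apply: LocUM => //; apply: LocU_umono. Qed.

(** By [Fpat_base] the value is a unit times a Laurent polynomial evaluated at the coefficients of
    [t], and these are units by [Ypat_Fpat]. *)
Lemma Loc_base R s t u i : xall n * R != 0 ->
  (forall l, LocU (xall n * R) (Fu s t l)) ->
  (forall l, Loc (xall n) (Fu t u l)) -> Loc (xall n * R) (Fu s u i).
Proof.
move=> R0 hU hL; have [h hE] := Fpat_base cM s t u.
have hY l : LocU (xall n * R) (Yu s t l).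
  rewrite Ypat_Fpat // fvalD !fval_sum; apply: LocUM.
    by apply: LocU_prod => m; rewrite fvalMz fval_Uvar -umono_delta;
      apply/LocUX/LocU_umono.
  by apply: LocU_prod => m; rewrite fvalMz; apply: LocUX.
rewrite hE fvalD; apply: LocM.
  rewrite fvalD fval_Umono_sum; apply: (proj1 (LocUM _ _)); first exact: LocU_umono.
  by rewrite fval_sum; apply: LocU_prod => l; rewrite fvalMz; apply: LocUX.
have [l [l' [_ e]]] := laurent_of_Loc (hL i).
have := slift_laurent (ueval_mono (Ypat M s (Uvar n) t)) e.
rewrite -[slift _ _]/(ueval (Ypat M s (Uvar n) t) _) ueval_Fpat // => {}e.
have hm g : Loc (xall n * R) (fval (ueval_mono (Ypat M s (Uvar n) t) g)).
  by rewrite fval_sum; apply: (proj1 (LocU_prod _ _)) => m; rewrite fvalMz; apply: LocUX.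
rewrite -[X in Loc _ X](addrK (\sum_(g <- l') fval (ueval_mono (Ypat M s (Uvar n) t) g))) e.
by apply: LocD; [|apply: LocN]; apply: Loc_sum.
Qed.

(** Induction on the length of a word. The base is moved once along the first edge and once to the
    end of a detour [k1], [k2], [k1]; the two denominators obtained are then glued. *)
Theorem laurent_phenomenon s t i : Loc (xall n) (Fu s t i).
Proof.
rewrite -(walk_geodesic s t); move: (geodesic s t) => w {t}.
have [m] := ubnP (size w); elim: m => // m IH in s w i *.
case/lastP: w => [_|w k1]; first by rewrite Fu_init; apply: Loc1.
rewrite size_rcons ltnS walk_rcons => szw.
have Loc_first : Loc (xall n) (Fu s (nbr k1 s) i).
  have [->|ik] := eqVneq i k1; last by rewrite Fu_nbr_neq // Fu_init; apply: Loc1.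
  case: (Fu_first s k1) => g ->; apply: LocM.
    by have := LocU_umono g; move=> /(_ 1); rewrite mulr1 => /(_ (xall_neq0 n)) [].
  by rewrite -(rmorph1 (@tofrac mp)) -rmorphD; apply: Loc_mpoly.
case/lastP: w szw => [_|w k2]; first exact: Loc_first.
rewrite size_rcons walk_rcons => szw; have [->|k21] := eqVneq k2 k1.
  by rewrite nbrK; apply: IH; apply: ltnW.
have [A [A' [hA hA' eA eA']]] := Fu_rank_two s k21.
have R1 : xall n * (1 + 'X_k1) != 0 by rewrite mulf_neq0 ?xall_neq0 ?onepX_neq0.
have AA : theta k1 (A * A') != 0 by rewrite rmorphM mulf_neq0.
have AA0 : A * A' != 0 by apply: contraNneq AA => ->; rewrite rmorph0.
have R3 : xall n * (A * A') != 0 by rewrite mulf_neq0 ?xall_neq0.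
apply: (Loc_glue AA).
  apply: (@Loc_base _ s (nbr k1 s)) => // l.
    have [->|lk] := eqVneq l k1; last by rewrite Fu_nbr_neq // Fu_init; apply: LocU1.
    apply: LocU_meq (Fu_first s k1) _ => //.
    rewrite -(rmorph1 (@tofrac mp)) -rmorphD; apply: (LocU_dvd R1 (q := xall n)).
    by rewrite mulrC.
  by have := IH (nbr k1 s) (rcons w k2) l; rewrite walk_rcons size_rcons; apply.
(* From the end of the detour one goes back along [k1] and then follows [w], so this word too is one
   letter shorter than the original. *)
apply: (@Loc_base _ s (nbr k1 (nbr k2 (nbr k1 s)))) => // l.
  have [->|lk1] := eqVneq l k1.
    apply: LocU_meq eA' _ => //; apply: (LocU_dvd R3 (q := xall n * A)).
    by rewrite mulrCA [A' * A]mulrC.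
  rewrite Fu_nbr_neq //; have [->|lk2] := eqVneq l k2.
    apply: LocU_meq eA _ => //; apply: (LocU_dvd R3 (q := xall n * A')).
    by rewrite mulrCA.
  by rewrite !Fu_nbr_neq // Fu_init; apply: LocU1.
have := IH (nbr k1 (nbr k2 (nbr k1 s))) (rcons w k1) l.
by rewrite walk_rcons nbrK size_rcons; apply.
Qed.

End LaurentPhenomenon.

(** * Tropical F-polynomials *)

Section TropicalF.
Variables (n : nat) (M : tree n -> 'M[int]_n) (cM : coherent M).
Implicit Types w : {ffun 'I_n -> int}.

(** While all F vanish, [Y_k] is the pairing of [w] with the [k]-th column of the C-matrix;
    sign-coherence gives [e * Y_k] nonnegative, and its minimum with [0] is [0]. *)
Lemma Fpat_int_pos s w t i : (forall m, 0 <= w m) -> Fpat M s w t i = 0.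
Proof.
move=> w0; move: t i; apply: (@tree_ind _ s) => [i|t k IH i].
  by rewrite Fpat_init ffunE.
rewrite Fpat_nbr // ffunE; case: eqVneq => [_|//].
rewrite IH oppr0 add0r big1 ?add0r => [|j _]; last by rewrite IH mul0rz.
apply: min_r; rewrite Ypat_Fpat // [X in _ + X]big1 ?addr0 => [|j _]; last first.
  by rewrite IH mul0rz.
have [_ _ h] := Cmx_sign cM s t k.
rewrite mulrz_suml sumr_ge0 // => j _; rewrite -mulrzA -mulrzr intz.
by rewrite mulr_ge0 // mulrC.
Qed.

Lemma Ypat_int_pos s w t j : (forall m, 0 <= w m) ->
  Ypat M s w t j = \sum_i w i * Cmx M s t i j.
Proof.
move=> w0; rewrite Ypat_Fpat // [X in _ + X]big1 ?addr0 => [|i _].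
  by apply: eq_bigr => i _; rewrite -mulrzr intz.
by rewrite Fpat_int_pos ?mul0rz.
Qed.

(* The tropical F-polynomial is superadditive, as the minimum of the weights of
   the terms of a Laurent polynomial, and it vanishes on nonnegative vectors. *)
Lemma Fpat_int_le0 s w t i : Fpat M s w t i <= 0.
Proof.
have [l [l' hl]] := laurent_of_Loc (laurent_phenomenon cM s t i).
pose c : int := (\sum_m `|w m|)%N.
have wc m : w m <= c by rewrite /c (bigD1 m) //=; lia.
pose w0 : {ffun 'I_n -> int} := [ffun=> c].
(* The vector [w] is completed by [w1] to the constant vector [w0]; both [w0] and [w1] are
   nonnegative. *)
pose w1 : {ffun 'I_n -> int} := [ffun m => c - w m].
have h g : ueval_mono w0 g = ueval_mono w g + ueval_mono w1 g.
  rewrite /ueval_mono -big_split; apply: eq_bigr => m _ /=.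
  by rewrite -mulrzDl !ffunE addrC subrK.
have := slift_superadditive hl h; rewrite -!/(ueval _ _) !ueval_Fpat //.
rewrite [X in _ + X <= _]Fpat_int_pos ?[X in _ <= X]Fpat_int_pos ?addr0 // => m.
  by rewrite ffunE.
by rewrite ffunE subr_ge0.
Qed.

(* A Laurent polynomial with trivial valuations is a constant. *)
Lemma Fpat_int_eq0 s t i : (forall w, Fpat M s w t i = 0) ->
  exists2 k : nat, fval (Fpat M s (Uvar n) t i) = k%:R &
  forall (y : {ffun 'I_n -> U n}), fval (Fpat M s y t i) = k%:R.
Proof.
move=> h0; have [l [l' hl]] := laurent_of_Loc (laurent_phenomenon cM s t i).
have g0 g : g \in l ++ l' -> g = 0.
  move=> gl; apply/ffunP=> m; rewrite ffunE.
  have ge0 w : 0 <= \sum_j w j * (g : {ffun 'I_n -> int}) j.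
    have [/(_ g gl) + _] := slift_valuation (ueval_mono w) hl.
    rewrite -/(ueval _ _) ueval_Fpat // h0 /= /ueval_mono.
    by congr (0 <= _); apply: eq_bigr => j _; rewrite -mulrzr intz.
  have sumd e : \sum_j [ffun j => if j == m then e else 0] j
      * (g : {ffun 'I_n -> int}) j = e * (g : {ffun 'I_n -> int}) m.
    rewrite (bigD1 m) //= ffunE eqxx big1 ?addr0 // => j jm.
    by rewrite ffunE (negPf jm) mul0r.
  have := ge0 [ffun j => if j == m then 1 else 0].
  have := ge0 [ffun j => if j == m then -1 else 0].
  have eq0 (a : int) : 0 <= -1 * a -> 0 <= 1 * a -> a = 0 by lia.
  by rewrite !sumd; apply: eq0.
(* All monomials are trivial and the lists are disjoint, so one of them is empty; it cannot be [l],
   since a sum of positive elements is nonzero. *)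
have l'E : l' = [::].
  case: l' => [//|g l'] in hl g0 *; have gg : g = 0.
    by apply: g0; rewrite mem_cat mem_head orbT.
  case: l => [|g' l] in hl g0; last first.
    by case: hl => /(_ g') + _; rewrite (g0 g') ?mem_head // gg mem_head => /(_ isT).
  case: hl => _ /eqP; rewrite [X in _ == X]big_nil => /eqP e.
  have pos : positive (E := Uemb n) (msum (g :: l')).
    by exists (g :: l'), [:: 0]; split=> //; rewrite msum1 me0 divr1.
  by have := positive_neq0 (positiveD (fvalP (Fpat M s (Uvar n) t i)) pos); rewrite e eqxx.
case: hl => _; rewrite l'E => e; exists (size l).
  move: e; rewrite /msum big_nil addr0 => ->.
  rewrite big_seq (eq_bigr (fun=> 1)) => [|g gl].
    by rewrite -big_seq sum1_countr count_predT.
  by rewrite (g0 g) ?me0 // l'E cats0.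
move=> y; have := slift_laurent (ueval_mono y) e.
rewrite -/(ueval _ _) ueval_Fpat // big_nil addr0 => ->.
rewrite big_seq (eq_bigr (fun=> 1)) => [|g gl].
  by rewrite -big_seq sum1_countr count_predT.
by rewrite (g0 g) ?raddf0 ?fval0 // l'E cats0.
Qed.

End TropicalF.

(** * Seeds with a permutation G-matrix *)

(** An off-diagonal entry of the product is a vanishing sum of nonnegative terms, so each term
    vanishes; a nonzero entry [B k m] then kills column [k] of [A] outside row [m]. *)
Lemma nonneg_inverse n (A B : 'M[int]_n) k : A *m B = 1%:M ->
  (forall i j, 0 <= A i j) -> (forall i j, 0 <= B i j) ->
  exists m, forall i, A i k = (i == m)%:R.
Proof.
move=> AB A0 B0; have BA := mulmx1C AB.
have [m Bkm] : exists m, B k m * A m k != 0.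
  apply/existsP; rewrite -[X in is_true X]negbK negb_exists; apply/negP => /forallP h.
  have := congr1 (fun C : 'M_n => C k k) BA; rewrite !mxE eqxx big1 // => m _.
  by apply/eqP; have := h m; rewrite negbK.
have {Bkm}[Bkm Amk] : B k m != 0 /\ A m k != 0.
  by move: Bkm; rewrite mulf_eq0 negb_or => /andP[].
have A00 i : i != m -> A i k = 0.
  move=> im; have := congr1 (fun C : 'M_n => C i m) AB; rewrite !mxE (negPf im).
  move=> /psumr_eq0P => /(_ (fun r _ => mulr_ge0 (A0 i r) (B0 r m)) k isT) /eqP.
  by rewrite mulf_eq0 (negPf Bkm) orbF => /eqP.
exists m => i; case: eqVneq => [->|/A00 //].
have sA : column_sign A k 1.
  by split=> [||r]; [left|exists m|rewrite mul1r].
by have [-> _] := unit_col_sign AB sA A00.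
Qed.

Section PermG.
Variables (n : nat) (M : tree n -> 'M[int]_n) (cM : coherent M).
Variables (s t : tree n) (sg : 'S_n).

Lemma perm_dual_of_G : (forall l i, Gmx M s t l i = (l == sg i)%:R) ->
  forall l i, Cmx (negtp M) s t l i = (l == sg i)%:R.
Proof.
move=> hG l i; have := congr1 (fun C : 'M_n => C l (sg i)) (Cmx_dual_Gmx cM s t).
rewrite !mxE => <-; rewrite (bigD1 i) //= mxE hG eqxx mulr1 big1 ?addr0 // => m mi.
by rewrite mxE hG (inj_eq perm_inj) eq_sym (negPf mi) mulr0.
Qed.

(** The positive columns of the dual C-matrix make [C] nonnegative, and the sign condition for [- M]
    does the same for its inverse. The columns of [C] are thus unit vectors, and it remains to
    locate them. *)
Lemma perm_C_of_G : (forall l i, Gmx M s t l i = (l == sg i)%:R) ->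
  forall l i, Cmx M s t l i = (l == sg i)%:R.
Proof.
move=> hG; have hD := perm_dual_of_G hG.
have sgnP (A : 'M[int]_n) k e : (exists i, A i k = 1) -> column_sign A k e -> e = 1.
  case=> i Ai [he _ /(_ i)]; rewrite Ai; case: he => ->; lia.
have C0 i k : 0 <= Cmx M s t i k.
  have [e [[he _ h] hN]] := coh_pos cM s t k.
  have e1 : e = 1 by apply: sgnP hN; exists (sg k); rewrite hD eqxx.
  by have := h i; rewrite e1 mul1r.
have C'0 i k : 0 <= Cmx (negp M) t s i k.
  have [e [[he _ h] hN]] := coh_neg cM t s k.
  have e1 : e = 1.
    apply: sgnP hN; exists ((sg^-1)%g k); have := hG k ((sg^-1)%g k).
    by rewrite permKV eqxx /Gmx mxE.
  by have := h i; rewrite e1 mul1r.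
move=> l k; have [m hm] := nonneg_inverse k (Cmx_duality s t cM) C0 C'0.
rewrite hm; suff -> : m = sg k by [].
(* Otherwise moving the base across the edge [m] negates the nonzero entry of column [k], but leaves
   the entry [1] of the dual column in row [sg k]; the signs would differ. *)
apply/eqP; apply: contraT => msk.
have [_ _ sM] := Cmx_sign cM (nbr m s) t k.
have [_ _ sD] := Cmx_sign (coherentNT cM) (nbr m s) t k.
move: (sM m) (sD (sg k)); rewrite (col_sgn_dual cM).
rewrite (Cmx_base cM) (Cmx_base (coherentNT cM)) !Emx_mul eqxx eq_sym (negPf msk).
rewrite hD hm !eqxx big1 ?addr0 => [|i im]; last by rewrite hm (negPf im) mulr0.
by case: (col_sgn_is_sign (Emx m (col_sgn (Cmx (negp M) t s) m) (- M s) *m Cmx M s t) k)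
  => ->; lia.
Qed.

(** Duality would only reach the C-matrix of [- M] from [t] to [s]. Instead a basis vector is
    transported tropically to [t] and back; both transports are linear on nonnegative vectors. *)
Lemma perm_C_inv : (forall l i, Cmx M s t l i = (l == sg i)%:R) ->
  forall i j, Cmx M t s i j = (j == sg i)%:R.
Proof.
move=> hC i j; pose w : {ffun 'I_n -> int} := [ffun m => (m == sg i)%:R].
have w0 m : 0 <= w m by rewrite ffunE ler0n.
have Yw m : Ypat M s w t m = (m == i)%:R.
  rewrite Ypat_int_pos // (bigD1 (sg m)) //= hC eqxx mulr1 big1 ?addr0.
    by rewrite ffunE (inj_eq perm_inj).
  by move=> l lm; rewrite hC (negPf lm) mulr0.
have := Ypat_trans cM s w t s; rewrite Ypat_init => /ffunP/(_ j).
rewrite Ypat_int_pos // => [|m]; last by rewrite Yw ler0n.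
rewrite (bigD1 i) //= Yw eqxx mul1r big1 ?addr0 => [->|m mi]; first by rewrite ffunE.
by rewrite Yw (negPf mi) mul0r.
Qed.

Lemma perm_M_of_G : (forall l i, Gmx M s t l i = (l == sg i)%:R) ->
  forall i j, M t i j = M s (sg i) (sg j).
Proof.
move=> hG i j; rewrite -[in LHS](Cmx_conj cM s t) !mxE (bigD1 (sg j)) //=.
rewrite (perm_C_of_G hG) eqxx mulr1 big1 ?addr0 => [|l lj]; last first.
  by rewrite (perm_C_of_G hG) (negPf lj) mulr0.
rewrite mxE (bigD1 (sg i)) //= mxE (perm_dual_of_G hG) eqxx mul1r big1 ?addr0 //.
by move=> l li; rewrite mxE (perm_dual_of_G hG) (negPf li) mul0r.
Qed.

End PermG.

Section PermF.
Variables (n : nat) (M : tree n -> 'M[int]_n) (cM : coherent M).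
Variables (s t : tree n) (sg : 'S_n).
Hypothesis hG : forall l i, Gmx M s t l i = (l == sg i)%:R.

Let G_inv l r : Gmx M t s r (sg l) = (l == r)%:R.
Proof.
have hD := perm_C_inv (coherentNT cM) (perm_dual_of_G cM hG).
have := congr1 (fun C : 'M_n => C l r) (Cmx_dual_Gmx cM t s).
rewrite mxE (bigD1 (sg l)) //= hD eqxx mul1r big1 => [|m ml].
  by rewrite addr0 /Gmx !mxE.
by rewrite hD (negPf ml) mul0r.
Qed.

(** Change of base along the closed route from [s] to [t] and back, where the F-polynomial is
    trivial. *)
Let F_inv l : exists h : 'I_n -> int, forall (V : sfType) (y : {ffun 'I_n -> V}),
  0 = \sum_m y m *~ h m + Fpat M s y t l + Fpat M t (Ypat M s y t) s (sg l).
Proof.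
have [h hE] := Fpat_base cM s t s; exists (fun m => h m (sg l)) => V y.
have := hE V y (sg l); rewrite Fpat_init ffunE => e; apply: (etrans e); congr (_ + _ + _).
rewrite (bigD1 l) //= G_inv eqxx mulr1z big1 ?addr0 // => m ml.
by rewrite G_inv eq_sym (negPf ml) mulr0z.
Qed.

(* The product of the two F-polynomials relating s and t is a monomial.  Both
   are tropically nonpositive, so that monomial is trivial, and both F are
   constants with product 1. *)
Lemma perm_F_of_G (V : sfType) (y : {ffun 'I_n -> V}) i : Fpat M s y t i = 0.
Proof.
have aux1 (a b c : int) : b <= 0 -> a <= 0 -> 0 = c + 0 + a + b -> 0 <= c by lia.
have aux2 (a b : int) : b <= 0 -> a <= 0 -> 0 = a + b -> a = 0 by lia.
have [h hE] := F_inv i.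
have h0 m : h m = 0.
  (* Basis vectors of both signs bound the exponent from both sides. *)
  have ge0 e : 0 <= e * h m.
    have := hE int [ffun j => if j == m then e else 0].
    have := Fpat_int_le0 cM s [ffun j => if j == m then e else 0] t i.
    have := Fpat_int_le0 cM t (Ypat M s [ffun j => if j == m then e else 0] t) s (sg i).
    rewrite (bigD1 m) //= ffunE eqxx big1 => [|j jm]; last first.
      by rewrite ffunE (negPf jm) mul0rz.
    by rewrite -mulrzr intz; apply: aux1.
  by have := ge0 1; have := ge0 (-1); lia.
have hE' (W : sfType) (z : {ffun 'I_n -> W}) :
    0 = Fpat M s z t i + Fpat M t (Ypat M s z t) s (sg i).
  by rewrite {1}(hE W z) big1 ?add0r // => m _; rewrite h0 mulr0z.
have T1 w : Fpat M s w t i = 0 :> int.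
  have := hE' int w; have := Fpat_int_le0 cM s w t i.
  by have := Fpat_int_le0 cM t (Ypat M s w t) s (sg i); apply: aux2.
have T2 w : Fpat M t w s (sg i) = 0 :> int.
  have := hE' int (Ypat M t w s); rewrite T1 add0r Ypat_trans // Ypat_init.
  by move=> <-.
have [k kE _] := Fpat_int_eq0 cM T1; have [k' _ k'E] := Fpat_int_eq0 cM T2.
have := congr1 (@fval _) (hE' _ (Uvar n)); rewrite fval0 fvalD kE k'E -natrM => e.
have /eqP : (k * k' = 1)%N.
  apply/eqP; have /eqP := e.
  rewrite -(rmorph_nat (@tofrac {mpoly int[n]})) -(rmorph1 (@tofrac {mpoly int[n]})) tofrac_eq.
  by rewrite -mpolyC_nat -mpolyC1 mpolyC_eq eq_sym pnatr_eq1.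
rewrite muln_eq1 => /andP[/eqP k1 _].
have Fu0 : Fpat M s (Uvar n) t i = 0 by apply: fval_inj; rewrite kE k1 fval0.
by rewrite -(ueval_Fpat y cM) Fu0 raddf0.
Qed.

End PermF.

Lemma eq_coherent n (M M' : tree n -> 'M[int]_n) :
  (forall u, M u = M' u) -> coherent M -> coherent M'.
Proof.
move=> e [hm hs hp hn]; split=> [t k|t|s t k|s t k]; rewrite -?e //.
  by rewrite -(eq_Cmx s t e) -(@eq_Cmx _ (negtp M) (negtp M')) // => u; rewrite e.
rewrite -(@eq_Cmx _ (negp M) (negp M')); last by move=> u; rewrite e.
by rewrite -(@eq_Cmx _ (fun u => (M u)^T) (fun u => (M' u)^T)) // => u; rewrite e.
Qed.

Lemma coherentT n (M : tree n -> 'M[int]_n) :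
  coherent M -> coherent (fun u => (M u)^T).
Proof.
move=> /coherentNT/coherentN; apply: eq_coherent => u; exact: opprK.
Qed.

(** * Linear independence in the fraction field and positive elements at a seed *)

Lemma sum_count (T : eqType) (V : nmodType) (f : T -> V) (r w : seq T) :
  uniq r -> {subset w <= r} ->
  \sum_(p <- r) f p *+ count_mem p w = \sum_(p <- w) f p.
Proof.
move=> ur; elim: w => [|q w IH] hw; first by rewrite big_nil big1.
rewrite big_cons -IH => [|p pw]; last by apply: hw; rewrite inE pw orbT.
rewrite (eq_bigr (fun p => f p *+ (q == p) + f p *+ count_mem p w)); last first.
  by move=> p _; rewrite -mulrnDr.
rewrite big_split /= (bigD1_seq q) ?hw ?mem_head //= eqxx big1 ?addr0 // => p pq.
by rewrite eq_sym (negPf pq).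
Qed.

Section GroupRing.
Variables (P : semifieldType) (K : fieldType) (iota : P -> K).
Hypothesis hK : is_QP iota.

(** The difference of multiplicities is an element of $\mathbb{ZP}$ with value zero in [K]. *)
Lemma iota_indep (u v : seq P) :
  \sum_(p <- u) iota p = \sum_(p <- v) iota p -> perm_eq u v.
Proof.
move=> e; pose d p : int := (count_mem p u)%:Z - (count_mem p v)%:Z.
pose A : {fset P} := seq_fset tt (u ++ v).
have memA q : (q \in A) = (q \in u ++ v) by rewrite seq_fsetE.
pose a : {fsfun P -> int with 0} := [fsfun p in A => d p].
have aE p : a p = d p.
  rewrite fsfunE memA; case: ifP => // /negbT; rewrite mem_cat => /norP[pu pv].
  by rewrite /d !(count_memPn _) // subrr.
have fA : (finsupp a `<=` A)%fset.
  by apply/fsubsetP=> p; rewrite mem_finsupp fsfunE; case: ifP => //; rewrite eqxx.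
have z0 : zp_eval iota a = 0.
  rewrite /zp_eval (big_fset_incl _ fA) => [|p _]; last first.
    by rewrite memNfinsupp => /eqP ->; rewrite mul0r.
  rewrite (eq_bigr (fun p => iota p *+ count_mem p u - iota p *+ count_mem p v)).
    rewrite sumrB !sum_count ?fset_uniq ?e ?subrr // => p pw; rewrite memA mem_cat pw //.
    by rewrite orbT.
  by move=> p _; rewrite aE /d rmorphB /= mulrBl -!pmulrn !mulr_natl.
apply/allP=> p _ /=; have := QP_inj hK z0 p; rewrite aE /d => /eqP.
by rewrite subr_eq0.
Qed.

End GroupRing.

Section SeedSemifield.
Variables (n : nat) (P : semifieldType) (K F : fieldType) (iota : P -> K).
Variables (hK : is_QP iota) (phi : {rmorphism K -> F}) (x : {ffun 'I_n -> F}).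
Hypothesis hx : free_generating_set phi x.
Notation G := {ffun 'I_n -> int}.

Let Phi_inj : forall p, mmap phi x p = 0 -> p = 0 := proj1 hx.

Definition smono (z : addsf P * G) : F := phi (iota z.1) * lmono (mmap phi x) z.2.

Lemma smono0 : smono 0 = 1.
Proof. by rewrite /smono lmono0 (QP_one hK) rmorph1 mulr1. Qed.

Lemma smonoD z z' : smono (z + z') = smono z * smono z'.
Proof.
by rewrite /smono (QP_mul hK) (lmonoD Phi_inj) rmorphM /= mulrACA.
Qed.

(** Independence over [K] separates the exponents; [iota_indep] then separates the coefficients at a
    fixed exponent. *)
Lemma smono_indep (l l' : seq (addsf P * G)) :
  \sum_(z <- l) smono z = \sum_(z <- l') smono z -> perm_eq l l'.
Proof.
move=> e; apply/allP=> -[p g] _; apply/eqP => /=.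
have := @lmono_indep n K F (mmap phi x) Phi_inj
  ([seq (iota z.1, z.2) | z <- l] ++ [seq (- iota z.1, z.2) | z <- l']).
rewrite big_cat /= !big_map /= => /(_ _ g).
rewrite big_cat /= !big_map /= sumrN => h.
have {h} : \sum_(z <- l | z.2 == g) iota z.1 = \sum_(z <- l' | z.2 == g) iota z.1.
  apply/eqP; rewrite -subr_eq0; apply/eqP; apply: h.
  under eq_bigr do rewrite mmapC.
  under [X in _ + X]eq_bigr do rewrite mmapC raddfN mulNr.
  by rewrite sumrN; move: e; rewrite /smono => ->; rewrite subrr.
have toseq (w : seq (addsf P * G)) : \sum_(z <- w | z.2 == g) iota z.1 =
    \sum_(q <- [seq z.1 | z <- w & z.2 == g]) iota q by rewrite big_map big_filter.
rewrite !toseq => /(iota_indep hK)/seq.permP/(_ (pred1 p)).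
have cnt (w : seq (addsf P * G)) :
    count (pred1 p) [seq z.1 | z <- w & z.2 == g] = count_mem (p, g) w.
  rewrite count_map count_filter; apply: eq_count => -[q h] /=.
  by rewrite -[RHS]/((q == p) && (h == g)).
by rewrite !cnt.
Qed.

Definition Semb : mono_emb := MonoEmb smono0 smonoD smono_indep.

Definition spar (p : addsf P) : posT Semb := mono ((p, 0) : meG Semb).
Definition svar (l : 'I_n) : posT Semb := mono ((0, delta l) : meG Semb).

Lemma spar_is_additive : zmod_morphism spar.
Proof.
move=> p q; rewrite /spar -raddfB; congr mono.
by rewrite -[RHS]/(p - q, 0 - 0 : G) subr0.
Qed.

HB.instance Definition _ :=
  GRing.isZmodMorphism.Build (addsf P) (posT Semb) spar spar_is_additive.

Lemma fval_spar p : fval (spar p) = phi (iota p).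
Proof. by rewrite fval_mono /= /smono lmono0 mulr1. Qed.

Lemma fval_svar l : fval (svar l) = x l.
Proof.
rewrite fval_mono /= /smono (QP_one hK) rmorph1 mul1r /lmono (bigD1 l) //=.
rewrite ffunE eqxx expr1z big1 ?mulr1 => [|j jl]; last first.
  by rewrite ffunE (negPf jl) expr0z.
by rewrite mmapX mmap1U.
Qed.

Section Tropical.
Variable a : {ffun 'I_n -> int}.

Definition strop_mono (z : meG Semb) : int := \sum_l a l * (z : addsf P * G).2 l.

Lemma strop_mono_additive : zmod_morphism strop_mono.
Proof.
by move=> z z'; rewrite /strop_mono -sumrB; apply: eq_bigr => l _; rewrite !ffunE mulrBr.
Qed.

HB.instance Definition _ :=
  GRing.isZmodMorphism.Build (meG Semb) int strop_mono strop_mono_additive.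

Definition strop : {additive posT Semb -> int} := slift strop_mono.

Lemma strop_oadd : {morph strop : z z' / oadd z z'}.
Proof. exact: slift_oadd. Qed.

Lemma strop_spar p : strop (spar p) = 0.
Proof.
by rewrite /= slift_mono /= /strop_mono big1 // => l _; rewrite ffunE mulr0.
Qed.

Lemma strop_svar l : strop (svar l) = a l.
Proof.
rewrite /= slift_mono /= /strop_mono (bigD1 l) //= ffunE eqxx mulr1 big1 ?addr0 //.
by move=> j jl; rewrite ffunE (negPf jl) mulr0.
Qed.

End Tropical.
End SeedSemifield.

(** * Cluster patterns *)

Section ClusterPattern.
Variables (n : nat) (P : semifieldType) (K F : fieldType) (iota : P -> K).
Variables (hK : is_QP iota) (phi : {rmorphism K -> F}) (S : tree n -> seed n P F).
Hypothesis hS : cluster_pattern iota phi S.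
Hypothesis hB : sign_assumption (fun t => exmx (S t)).

Let B t := exmx (S t).

Lemma exmx_coherent : coherent B.
Proof.
split=> [t k|t|s t k|s t k].
- by rewrite /B (proj2 hS).
- by have [_ /(_ [::])] := proj1 hS t.
- by apply: hB; left.
have := hB (or_intror erefl) s t k.
rewrite (@eq_Cmx _ (fun u => - (- exmx (S u))^T) (fun u => (B u)^T)) //.
by move=> u; rewrite trmxN opprK.
Qed.

Let cB := exmx_coherent.

Definition ycoef t : {ffun 'I_n -> addsf P} := coef (S t).

Lemma ycoef_Ypat s t : ycoef t = Ypat B s (ycoef s) t.
Proof.
move: t; apply: (@tree_ind _ s) => [|t k IH]; first by rewrite Ypat_init.
rewrite Ypat_nbr // -IH /ycoef (proj2 hS) /=; apply/ffunP=> i; rewrite !ffunE.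
case: ifP => // _; rewrite !addsfMz -[X in _ = X]/(_ * _ * _)%g; congr (_ * _)%g.
by rewrite -[RHS]/(- _ : addsf P) -addsfMz -mulrNz addsfMz.
Qed.

Section Base.
Variable s : tree n.

Let hx : free_generating_set phi (clu (S s)) := proj1 (proj1 hS s).
Notation E := (Semb hK hx).
Notation xs := (svar hK hx).
Notation pp := (spar hK hx).

Definition yhat : {ffun 'I_n -> posT E} :=
  [ffun j => pp (ycoef s j) + \sum_i xs i *~ B s i j].

(** The separation formula $x_s^{g_i}F_{i;t}(\hat y)/F_{i;t}|_{\mathbb P}(y)$, written
    additively. *)
Definition xpos t i : posT E :=
  \sum_l xs l *~ Gmx B s t l i + Fpat B s yhat t i - pp (Fpat B s (ycoef s) t i).

(** The elements $\hat y$ mutate like coefficients; the exponents of the initial variables agree by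
    [Gmx_mul]. *)
Lemma yhat_Ypat t k :
  Ypat B s yhat t k = pp (ycoef t k) + \sum_i xpos t i *~ B t i k.
Proof.
rewrite (ycoef_Ypat s t) !Ypat_Fpat // raddfD !raddf_sum /=.
under [X in _ = _ + _ + X]eq_bigr do rewrite /xpos mulrzBl mulrzDl.
rewrite sumrB big_split /=.
have -> : \sum_i (\sum_l xs l *~ Gmx B s t l i) *~ B t i k =
    \sum_j (\sum_l xs l *~ B s l j) *~ Cmx B s t j k.
  have -> : \sum_i (\sum_l xs l *~ Gmx B s t l i) *~ B t i k =
      \sum_l xs l *~ (Gmx B s t *m B t) l k.
    under eq_bigr do rewrite mulrz_suml.
    rewrite exchange_big; apply: eq_bigr => l _ /=; rewrite mxE mulrz_sumr.
    by apply: eq_bigr => i _; rewrite mulrzA.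
  rewrite Gmx_mul //; under [RHS]eq_bigr do rewrite mulrz_suml.
  rewrite exchange_big; apply: eq_bigr => l _ /=; rewrite mxE mulrz_sumr.
  by apply: eq_bigr => i _; rewrite mulrzA.
under eq_bigr do rewrite ffunE mulrzDl.
under [X in _ = X + _ + _]eq_bigr do rewrite raddfMz.
under [X in _ = _ + X + _]eq_bigr do rewrite raddfMz.
rewrite big_split /=; zmod.
Qed.

Lemma xpos_nbr_neq t k i : i != k -> xpos (nbr k t) i = xpos t i.
Proof.
move=> ik; rewrite /xpos !Fpat_nbr_neq //; congr (_ + _ - _).
by apply: eq_bigr => l _; rewrite Gmx_nbr // (negPf ik).
Qed.

Lemma xpos_nbr t k (e := col_sgn (Cmx B s t) k) : xpos (nbr k t) k =
  - xpos t k + \sum_j xpos t j *~ pospart (- (e * B t j k))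
  + oadd (Ypat B s yhat t k *~ e) 0 - pp (oadd (ycoef t k *~ e) 0).
Proof.
rewrite {1}/xpos !Fpat_nbr // -/e !ffunE eqxx -(ycoef_Ypat s t).
under eq_bigr do rewrite Gmx_nbr // -/e eqxx mulrzDr mulrNz mulrz_sumr.
rewrite big_split /= sumrN exchange_big /=.
have -> : \sum_j xpos t j *~ pospart (- (e * B t j k)) =
    \sum_j \sum_l xs l *~ (Gmx B s t l j * pospart (- (e * B t j k)))
    + \sum_j Fpat B s yhat t j *~ pospart (- (e * B t j k))
    - pp (\sum_j Fpat B s (ycoef s) t j *~ pospart (- (e * B t j k))).
  rewrite raddf_sum /= -big_split -sumrB; apply: eq_bigr => j _ /=.
  rewrite /xpos mulrzBl mulrzDl [pp (_ *~ _)]raddfMz mulrz_suml; congr (_ + _ - _).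
  by apply: eq_bigr => l _; rewrite mulrzA.
rewrite !raddfD raddfN /= /xpos; zmod.
Qed.

Lemma clu_xpos t i : clu (S t) i = fval (xpos t i).
Proof.
move: t i; apply: (@tree_ind _ s) => [i|t k IH i].
  rewrite /xpos !Fpat_init !ffunE [pp 0]raddf0 subr0 addr0 Gmx_init (bigD1 i) //=.
  rewrite mxE eqxx mulr1z big1 => [|l li]; first by rewrite addr0 fval_svar.
  by rewrite mxE (negPf li) mulr0z.
rewrite (proj2 hS) /= ffunE; case: eqVneq => [->|ik]; last by rewrite xpos_nbr_neq.
pose y := ycoef t k.
have exch : (phi (iota y) * (\prod_j clu (S t) j ^ pospart (B t j k))
    + \prod_j clu (S t) j ^ pospart (- B t j k))
    / (phi (iota (oplus y 1%g)) * clu (S t) k) =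
  fval (oadd (pp y + \sum_j xpos t j *~ pospart (B t j k))
             (\sum_j xpos t j *~ pospart (- B t j k))
        - pp (oadd y 0) - xpos t k).
  rewrite !fvalD !fvalN fval_oadd fvalD !fval_sum !fval_spar IH invfM mulrA.
  congr ((_ * _ + _) / _ / _); apply: eq_bigr => j _; by rewrite fvalMz IH.
rewrite exch xpos_nbr; refine (congr1 (@fval E) _).
have hs : \sum_j xpos t j *~ pospart (- B t j k) =
    \sum_j xpos t j *~ pospart (B t j k) - \sum_j xpos t j *~ B t j k.
  by rewrite -sumrB; apply: eq_bigr => j _; rewrite pospartN mulrzBr.
rewrite yhat_Ypat -/y; set T := \sum_j xpos t j *~ B t j k in hs *.
set T1 := \sum_j xpos t j *~ pospart (B t j k) in hs *.
(* The monomial with exponents $[-b_{jk}]_+$ is factored out of the exchange polynomial, leaving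
   $\hat y_k+1$. *)
have oE : oadd (pp y + T1) (\sum_j xpos t j *~ pospart (- B t j k)) =
    T1 - T + oadd (pp y + T) 0.
  by rewrite addr_oaddr hs; congr oadd; zmod.
rewrite oE; case: (col_sgn_is_sign (Cmx B s t) k) => ->.
  rewrite !mulr1z; under eq_bigr do rewrite mul1r.
  by rewrite hs; zmod.
rewrite !mulrN1z !oaddN0 [pp (_ - _)]raddfB; under eq_bigr do rewrite mulN1r opprK.
by rewrite -/T1; zmod.
Qed.

(* The tropical value of F is nonpositive, and the other two terms are linear. *)
Lemma Gmx_of_clu t i j : clu (S t) i = clu (S s) j ->
  forall l, Gmx B s t l i = (l == j)%:R.
Proof.
move=> e; have ex : xpos t i = xs j.
  by apply: fval_inj; rewrite -clu_xpos e fval_svar.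
have ge (a : {ffun 'I_n -> int}) : a j <= \sum_l a l * Gmx B s t l i.
  have := congr1 (strop hK hx a) ex; rewrite strop_svar.
  have [h [h_oadd h_par h_var]] : exists h : {additive posT E -> int},
      [/\ {morph h : z z' / oadd z z'}, forall p, h (pp p) = 0,
          forall l, h (xs l) = a l & h =1 strop hK hx a].
    exists (strop hK hx a); split=> //; first exact: strop_oadd.
      exact: strop_spar.
    exact: strop_svar.
  move=> <-; rewrite /xpos [h _]raddfB [h (_ + _)]raddfD h_par subr0 [h _]raddf_sum.
  rewrite (Fpat_morph cB h_oadd) => <-.
  rewrite (eq_bigr (fun l => a l * Gmx B s t l i)) => [|l _].
    by rewrite gerDl Fpat_int_le0.
  by rewrite [h _]raddfMz h_var -mulrzr intz.
(* An inequality between linear forms, tested at plus and minus a basis vector, is an equality. *)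
move=> l; have sumd c : \sum_m [ffun m => if m == l then c else 0] m * Gmx B s t m i
    = c * Gmx B s t l i.
  rewrite (bigD1 l) //= ffunE eqxx big1 ?addr0 // => m ml.
  by rewrite ffunE (negPf ml) mul0r.
have := ge [ffun m => if m == l then 1 else 0].
have := ge [ffun m => if m == l then -1 else 0].
by rewrite !sumd !ffunE eq_sym; case: eqVneq => _; lia.
Qed.

Lemma seed_of_Gmx t (sg : 'S_n) :
  (forall l i, Gmx B s t l i = (l == sg i)%:R) -> S t = perm_seed sg (S s).
Proof.
move=> hG; have F0 := perm_F_of_G cB hG.
have cluE : clu (S t) = perm_ffun sg (clu (S s)).
  apply/ffunP=> i; rewrite ffunE (clu_xpos t) /xpos !F0 [pp 0]raddf0 subr0 addr0.
  rewrite (bigD1 (sg i)) //= hG eqxx mulr1z big1 => [|l li].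
    by rewrite addr0 fval_svar.
  by rewrite hG (negPf li) mulr0z.
have coefE : coef (S t) = perm_ffun sg (coef (S s)).
  apply/ffunP=> i; rewrite -[LHS]/(ycoef t i) (ycoef_Ypat s t) Ypat_Fpat // ffunE.
  rewrite [X in _ + X]big1 ?addr0 => [|j _]; last by rewrite F0 mul0rz.
  rewrite (bigD1 (sg i)) //= (perm_C_of_G cB hG) eqxx mulr1z big1 ?addr0 // => l li.
  by rewrite (perm_C_of_G cB hG) (negPf li) mulr0z.
have exmxE : exmx (S t) = mxsub sg sg (exmx (S s)).
  by apply/matrixP=> i j; rewrite mxE; apply: (perm_M_of_G cB hG).
by case: (S t) cluE coefE exmxE => a b c /= -> -> ->.
Qed.

End Base.

Lemma clu_inj t : injective (clu (S t)).
Proof.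
move=> i j e; have := Gmx_of_clu e i; rewrite Gmx_init mxE eqxx.
by case: eqVneq => // _ /eqP.
Qed.

Lemma clu_nbr_neq t k i : i != k -> clu (S (nbr k t)) i = clu (S t) i.
Proof. by move=> ik; rewrite (proj2 hS) /= ffunE (negPf ik). Qed.

(** The g-vector of the new variable relative to [t] has entry [-1] in row [k], so it is not a unit
    vector. *)
Lemma clu_nbr_new t k j : clu (S (nbr k t)) k <> clu (S t) j.
Proof.
move=> /Gmx_of_clu /(_ k); rewrite Gmx_nbr ?Gmx_init; last exact: cB.
rewrite eqxx mxE eqxx big1 => [|i _]; first by case: (k == j).
rewrite mxE; case: eqVneq => [<-|_]; last by rewrite mul0r.
by rewrite (coh_diag cB) mulr0 oppr0 pospart0 mulr0.
Qed.

(* If n - 1 variables are common, row and column sign-coherence force the last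
   column of the G-matrix to be a unit vector. *)
Lemma seed_of_common s t (sg : 'S_n) k :
  (forall i, i != k -> clu (S t) i = clu (S s) (sg i)) ->
  Gmx B s t (sg k) k = 1 -> S t = perm_seed sg (S s).
Proof.
move=> hc g1; apply: seed_of_Gmx.
have hG l i : i != k -> Gmx B s t l i = (l == sg i)%:R.
  by move=> /hc/Gmx_of_clu ->.
pose D := Cmx (negtp B) s t.
have DG : D^T *m Gmx B s t = 1%:M.
  apply: mulmx1C; rewrite -[Gmx B s t]trmxK -trmx_mul -trmx1.
  by congr trmx; apply: Cmx_dual_Gmx.
have Hij i j : j != k -> D (sg j) i = (i == j)%:R.
  move=> jk; have := congr1 (fun A : 'M_n => A i j) DG; rewrite /= mxE [RHS]mxE => <-.
  rewrite (bigD1 (sg j)) //= hG // eqxx mulr1 mxE big1 ?addr0 // => l lj.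
  by rewrite hG // (negPf lj) mulr0.
move=> l i; have [->|ik] := eqVneq i k; last exact: hG.
have [->|lk] := eqVneq l (sg k); first exact: g1.
pose j := (sg^-1)%g l; have lE : l = sg j by rewrite permKV.
have jk : j != k by apply: contraNneq lk => <-; rewrite lE.
have e0 : Gmx B s t l k + D (sg k) j = 0.
  have := congr1 (fun A : 'M_n => A j k) DG; rewrite /= mxE [RHS]mxE (negPf jk) => e.
  refine (etrans _ e).
  rewrite (bigD1 l) //= (bigD1 (sg k)) //= 1?eq_sym // g1 mulr1 [D^T _ l]mxE.
  rewrite lE (Hij j j jk) eqxx mul1r [D^T _ _]mxE addrA -[LHS]addr0; congr (_ + _).
  rewrite big1 // => m /andP[ml mk]; pose m' := (sg^-1)%g m.
  have mE : m = sg m' by rewrite permKV.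
  have mk' : m' != k by apply: contraNneq mk => <-; rewrite mE.
  rewrite mxE mE Hij //; case: eqVneq => [jm|_]; last by rewrite mul0r.
  by case/eqP: ml; rewrite mE -jm.
(* Column [j] of [D] contains [1] in row [sg j], and row [l] of the G-matrix contains [1] in column
   [j]. By sign-coherence both summands of [e0] are nonnegative, hence zero. *)
have D0 : 0 <= D (sg k) j.
  have [he _ h] := Cmx_sign (coherentNT cB) s t j.
  by have := h (sg j); have := h (sg k); rewrite -/D (Hij j j jk) eqxx; case: he => ->; lia.
have G0 : 0 <= Gmx B s t l k.
  have [he _ h] := Cmx_sign (coherentT cB) t s l.
  have := h j; have := h k; have := hG l j jk; rewrite -lE eqxx /Gmx !mxE => ->.
  by case: he => ->; lia.
by move: e0 D0 G0; case: (l == k); lia.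
Qed.

(** Row [sg k] of the G-matrix vanishes outside column [k], so this entry is invertible over the
    integers. *)
Lemma Gmx_unit s t (sg : 'S_n) k :
  (forall i, i != k -> clu (S t) i = clu (S s) (sg i)) ->
  Gmx B s t (sg k) k = 1 \/ Gmx B s t (sg k) k = -1.
Proof.
move=> hc.
have := congr1 (fun A : 'M_n => A (sg k) (sg k)) (Cmx_dual_Gmx cB s t).
rewrite /= mxE [RHS]mxE eqxx (bigD1 k) //= big1 ?addr0 => [|i ik]; last first.
  have := Gmx_of_clu (hc i ik) (sg k); rewrite (inj_eq perm_inj) eq_sym (negPf ik).
  by move=> e; rewrite [X in _ * X]mxE e mulr0.
rewrite [X in _ * X]mxE; move: (Gmx _ _ _ _ _) (Cmx _ _ _ _ _) => a b ab.
have /eqP : (`|b| * `|a|)%N = 1%N by rewrite -abszM ab.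
by rewrite muln_eq1 => /andP[_ /eqP]; lia.
Qed.

(** Moving the base vertex is a C-step for the pattern $M^T$ based at [t], which negates a column of
    that C-matrix, that is, a row of the G-matrix. *)
Lemma Gmx_base_neg s t (sg : 'S_n) k :
  Gmx B (nbr (sg k) s) t (sg k) k = - Gmx B s t (sg k) k.
Proof. by rewrite /Gmx !mxE (Cmx_nbr (coherentT cB)) mul_Emx eqxx. Qed.

End ClusterPattern.

(** * Clusters with all but one variable in common *)

Section CommonVariables.
Variables (n : nat) (P : semifieldType) (F : fieldType).
Implicit Types S : seed n P F.

Lemma mem_cluster S z : reflect (exists i, z = clu S i) (z \in cluster S).
Proof.
apply: (iffP (imfsetP _ _ _ _)) => [[i _ ->]|[i ->]]; first by exists i.
by exists i.
Qed.

Lemma cluster_perm S S' (a a' : 'S_n) :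
  perm_ffun a (clu S) = perm_ffun a' (clu S') -> cluster S = cluster S'.
Proof.
move=> /ffunP e; apply/fsetP=> z; apply/mem_cluster/mem_cluster=> -[i ->].
  by exists (a' (a^-1 i)%g); have := e (a^-1 i)%g; rewrite !ffunE permKV.
by exists (a (a'^-1 i)%g); have := e (a'^-1 i)%g; rewrite !ffunE permKV.
Qed.

Lemma card_common S S' : injective (clu S') ->
  #|` (cluster S `&` cluster S')%fset | = #|[set i | clu S' i \in cluster S]|.
Proof.
move=> inj; have -> : (cluster S `&` cluster S')%fset =
    [fset clu S' i | i in [set i | clu S' i \in cluster S]]%fset.
  apply/fsetP=> z; rewrite inE; apply/andP/imfsetP => [[zS /mem_cluster[i zE]]|[i]].
    by exists i; rewrite //= inE -zE.
  by rewrite /= inE => h ->; split=> //; apply/mem_cluster; exists i.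
by rewrite card_imfset //= -cardE.
Qed.

Lemma common_perm S S' : injective (clu S) -> injective (clu S') ->
  (#|` (cluster S `&` cluster S')%fset |).+1 = n ->
  exists (sg : 'S_n) k,
    clu S' k \notin cluster S /\ forall i, i != k -> clu S' i = clu S (sg i).
Proof.
move=> inj inj' e.
have one (A : {set 'I_n}) : #|A|.+1 = n -> exists k, forall i, (i \notin A) = (i == k).
  move=> eA; have /cards1P[k kE] : #|~: A| == 1%N.
    by have := cardsC A; rewrite card_ord; lia.
  by exists k => i; rewrite -in_setC kE inE.
have [k kE] := one _ (etrans (congr1 succn (esym (card_common _ inj'))) e).
have [k0 k0E] := one _ (etrans (congr1 succn (esym (card_common S' inj)))
  (etrans (congr1 (fun A => (#|` A|).+1) (fsetIC _ _)) e)).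
have hk i : i != k -> exists j, clu S' i == clu S j.
  rewrite -kE negbK inE => /mem_cluster[j ->]; by exists j.
(* The default [k0], the index of [S] left unmatched, is taken exactly at [k] and completes the
   matching to a permutation. *)
pose f i := if [pick j | clu S' i == clu S j] is Some j then j else k0.
have fE i : i != k -> clu S' i = clu S (f i).
  move=> /hk[j ej]; rewrite /f; case: pickP => [j' /eqP //|/(_ j)].
  by rewrite ej.
have fk : f k = k0.
  rewrite /f; case: pickP => // j /eqP ej; have := kE k; rewrite eqxx inE.
  by move/negP; case; apply/mem_cluster; exists j.
have fk0 i : i != k -> f i != k0.
  move=> ik; rewrite -k0E negbK inE -fE //; apply/mem_cluster; by exists i.
have f_inj : injective f.
  move=> i j; have [->|ik] := eqVneq i k; have [->|jk] := eqVneq j k => //.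
  - by rewrite fk => /esym/eqP; rewrite (negPf (fk0 j jk)).
  - by rewrite fk => /eqP; rewrite (negPf (fk0 i ik)).
  by move=> eij; apply: inj'; rewrite !fE // eij.
exists (perm f_inj), k; split=> [|i ik]; last by rewrite permE fE.
by have := kE k; rewrite eqxx inE.
Qed.

Lemma clu_mut_perm (emb : P -> F) k (a : 'S_n) S :
  clu_mut emb k (perm_seed a S) = perm_ffun a (clu_mut emb (a k) S).
Proof.
apply/ffunP=> i; rewrite !ffunE (inj_eq perm_inj); case: ifP => // _.
congr ((_ * _ + _) / _).
  rewrite [RHS](reindex_inj (@perm_inj _ a)) /=.
  by apply: eq_bigr => j _; rewrite !ffunE mxE.
rewrite [RHS](reindex_inj (@perm_inj _ a)) /=.
by apply: eq_bigr => j _; rewrite !ffunE mxE.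
Qed.

Lemma same_unlabeled_seed_perm (a : 'S_n) S : same_unlabeled_seed (perm_seed a S) S.
Proof.
exists (a^-1)%g; case: S => x y B; rewrite /perm_seed /=; congr Seed.
- by apply/ffunP=> i; rewrite !ffunE permKV.
- by apply/ffunP=> i; rewrite !ffunE permKV.
by apply/matrixP=> i j; rewrite !mxE !permKV.
Qed.

Lemma same_unlabeled_seed_refl S : same_unlabeled_seed S S.
Proof.
exists 1%g; case: S => x y B; rewrite /perm_seed /=; congr Seed.
- by apply/ffunP=> i; rewrite !ffunE perm1.
- by apply/ffunP=> i; rewrite !ffunE perm1.
by apply/matrixP=> i j; rewrite !mxE !perm1.
Qed.

End CommonVariables.

Theorem theorem5p8 (n : nat) (P : semifieldType) (K F : fieldType)
    (iota : P -> K) (hK : is_QP iota) (phi : {rmorphism K -> F})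
    (S : tree n -> seed n P F) (hS : cluster_pattern iota phi S)
    (hB : sign_assumption (fun t => exmx (S t))) :
  (forall (s : 'S_n) (t t' : tree n),
     perm_ffun s (clu (S t')) = clu (S t) -> S t = perm_seed s (S t')) /\
  (forall t t' : tree n,
     exchange_adjacent (fun p => phi (iota p)) (S t) (S t') <->
     (#|` (cluster (S t) `&` cluster (S t'))%fset |).+1 = n).
Proof.
have inj t := clu_inj hK hS hB (t := t).
split=> [sg t t' e|t t'].
  apply: (seed_of_Gmx hK hS hB) => l i; apply: (Gmx_of_clu hK hS hB).
  by rewrite -e ffunE.
split=> [[_ [_ [k [[a ->] [a' ->] e]]]]|e].
  (* Direction [k] of the permuted seed is direction [a k] of [S t]. *)
  have -> : cluster (S t') = cluster (S (nbr (a k) t)).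
    apply: (@cluster_perm _ _ _ _ _ a' a).
    by rewrite (proj2 hS) -clu_mut_perm -[LHS]/(clu (perm_seed a' (S t'))) e.
  rewrite card_common //; set A := [set i | _].
  have -> : A = [set~ a k].
    apply/setP=> i; rewrite !inE; have [->|ik] := eqVneq i (a k).
      by apply/negbTE/negP => /mem_cluster[j] /(clu_nbr_new hK hS hB).
    by apply/mem_cluster; exists i; rewrite (clu_nbr_neq hS).
  by rewrite cardsC1 card_ord prednK // (leq_ltn_trans _ (ltn_ord k)).
have [sg [k [nk hc]]] := common_perm (inj t) (inj t') e.
(* The value [1] would make the two clusters equal, against [nk]. *)
have [g1|gN1] := Gmx_unit hK hS hB hc.
  have := seed_of_common hK hS hB hc g1 => eS; case/negP: nk.
  by apply/mem_cluster; exists (sg k); rewrite eS ffunE.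
(* For the value [-1], the base moves across the edge [sg k]: the common variables persist and the
   entry becomes [1]. *)
have hc' i : i != k -> clu (S t') i = clu (S (nbr (sg k) t)) (sg i).
  by move=> ik; rewrite (clu_nbr_neq hS) ?(inj_eq perm_inj) // hc.
have eS : S t' = perm_seed sg (S (nbr (sg k) t)).
  by apply: (seed_of_common hK hS hB hc'); rewrite (Gmx_base_neg hS hB) gN1.
exists (S t), (S (nbr (sg k) t)), (sg k); split.
- exact: same_unlabeled_seed_refl.
- by rewrite eS; apply: same_unlabeled_seed_perm.
exact: (proj2 hS).
Qed.
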